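(* Let $A\in M_n$, $B\in M_m$, $c\in\mathbb{R}^n$, $d\in\mathbb{R}^m$ with $W(A;c)$ and $W(B;d)$ nonempty. Suppose $W(A;c)$ and $W(B;d)$ have more than $\deg(A;c)\deg(B;d)$ pairwise distinct common supporting lines, and that: (1) either $W(A;c)=W_c(A)$, or $W(A;c)$ has nonempty interior and each of these common supporting lines touches $\partial W(A;c)$ at a point where $\partial W(A;c)$ is differentiable; (2) either $W(B;d)=W_d(B)$, or $W(B;d)$ has nonempty interior and each of these common supporting lines touches $\partial W(B;d)$ at a point where $\partial W(B;d)$ is differentiable. Then there exists a $c$-value of $A$ which is also a $d$-value of $B$. Furthermore, if $r(A;c)$ is irreducible in $\mathbb{C}[x,y,t]$, then every $c$-value of $A$ is a $d$-value of $B$.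
   Context: $M_n$ denotes the space of $n\times n$ complex matrices. For $A\in M_n$ and $\theta\in\mathbb{R}$, $H_\theta(A)=\frac{1}{2}(e^{i\theta}A+e^{-i\theta}A^* )$; for a Hermitian $H$, $\lambda_1(H)\ge\cdots\ge\lambda_n(H)$ are its eigenvalues in nonincreasing order with multiplicity. For $c\in\mathbb{R}^n$ the weighted numerical range is $W(A;c)=\bigcap_{\theta\in[0,2\pi)}\{v\in\mathbb{C}:\mathrm{Re}(e^{i\theta}v)\le\sum_{j=1}^n c_j\lambda_j(H_\theta(A))\}$, and the $c$-numerical range is $W_c(A)=\{\sum_{j=1}^n c_jx_j^*Ax_j:\ x_1,\dots,x_n\in\mathbb{C}^n\text{ orthonormal}\}$. A common supporting line of two nonempty sets $K_1,K_2\subseteq\mathbb{C}$ is a line $L$ meeting both sets such that $K_1$ and $K_2$ lie in the same closed half-plane bounded by $L$. For a general $M\in M_n$ let $\lambda_1(M),\dots,\lambda_n(M)$ be its eigenvalues with algebraic multiplicity. Let $i_1<\dots<i_r$ be the indices with $c_{i_s}\ne0$. A $c$-value of $M$ is $\sum_{s=1}^r c_{i_s}\lambda_{j_s}(M)$ with $j_1,\dots,j_r$ pairwise distinct. Call index tuples formally equivalent if the linear forms $\sum_s c_{i_s}X_{j_s}$, $\sum_s c_{i_s}X_{j'_s}$ in indeterminates coincide; with $\mathcal{F}$ a set of class representatives, $p(M;c)(t)=\prod_{(j_s)\in\mathcal{F}}(t-\sum_s c_{i_s}\lambda_{j_s}(M))$ and $\deg(M;c)=|\mathcal{F}|$. Set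 $r(A;c)(x,y,t)=p(xA+yA^*;c)(t)$, a homogeneous polynomial of degree $\deg(A;c)$. Analogous definitions for $B\in M_m$, $d\in\mathbb{R}^m$. *)

(* Defs.v *)
(* Complex numbers are modelled by an arbitrary
   numClosedFieldType C (e.g. algC); the reals are its real elements. *)
From HB Require Import structures.
From mathcomp Require Import all_boot all_order all_algebra.
Set Implicit Arguments. Unset Strict Implicit. Unset Printing Implicit Defensive.
Import Order.TTheory GRing.Theory Num.Theory.
Local Open Scope ring_scope.

(* conjugate transpose A^* *)
Definition adjmx (C : numClosedFieldType) (m n : nat) (A : 'M[C]_(m, n))
  : 'M[C]_(n, m) :=
  (map_mx (fun z => z^*) A)^T.

(* H_theta(A) with u = e^{i theta} ranging over the unit circle *)
Definition Hth (C : numClosedFieldType) (n : nat) (u : C) (A : 'M[C]_n) : 'M[C]_n :=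
  (2%:R)^-1 *: (u *: A + u^* *: adjmx A).

(* the eigenvalues of M, with algebraic multiplicity (a list of length n) *)
Definition eigs (C : numClosedFieldType) (n : nat) (M : 'M[C]_n) : seq C :=
  sval (closed_field_poly_normal (char_poly M)).

(* lambda_j(M), j = 0..n-1, for a general matrix (some fixed enumeration) *)
Definition eig (C : numClosedFieldType) (n : nat) (M : 'M[C]_n) (j : 'I_n) : C :=
  nth 0 (eigs M) j.

(* lambda_j(H) for Hermitian H: eigenvalues sorted in nonincreasing order
   (they are real, so sorting by real part is sorting by value) *)
Definition heig (C : numClosedFieldType) (n : nat) (H : 'M[C]_n) (j : 'I_n) : C :=
  nth 0 (sort (fun x y : C => 'Re y <= 'Re x) (eigs H)) j.

(* weighted numerical range W(A;c) *)
Definition Wrange (C : numClosedFieldType) (n : nat) (A : 'M[C]_n) (c : 'I_n -> C)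
  : C -> Prop :=
  fun v => forall u : C, `|u| = 1 ->
      'Re (u * v) <= \sum_(j < n) c j * heig (Hth u A) j.

(* c-numerical range W_c(A): x_1..x_n orthonormal = columns of a unitary X *)
Definition Wc (C : numClosedFieldType) (n : nat) (A : 'M[C]_n) (c : 'I_n -> C)
  : C -> Prop :=
  fun v => (exists X : 'M[C]_n, adjmx X *m X = 1%:M /\
      v = \sum_(j < n) (c j * (adjmx (col j X) *m A *m col j X) 0 0)).

(* lines in C: { z | Re(u z) = t } with u <> 0, t real *)
Definition line_of (C : numClosedFieldType) (u t : C) : C -> Prop :=
  fun z => 'Re (u * z) = t.

Definition is_line (C : numClosedFieldType) (L : C -> Prop) : Prop :=
  exists u t : C, u != 0 /\ t \is Num.real /\ (forall z, L z <-> line_of u t z).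

(* L is a common supporting line of K1 and K2 *)
Definition common_supporting_line (C : numClosedFieldType) (K1 K2 L : C -> Prop)
  : Prop :=
  (exists z, K1 z /\ L z) /\ (exists z, K2 z /\ L z) /\
  exists u t : C, [/\ u != 0, t \is Num.real, (forall z, L z <-> line_of u t z) &
    forall z, K1 z \/ K2 z -> 'Re (u * z) <= t].

(* supporting line of a single set K through the point p *)
Definition supporting_line_at (C : numClosedFieldType) (K L : C -> Prop) (p : C)
  : Prop :=
  L p /\ exists u t : C, [/\ u != 0, t \is Num.real, (forall z, L z <-> line_of u t z) &
    forall z, K z -> 'Re (u * z) <= t].

Definition interior_point (C : numClosedFieldType) (K : C -> Prop) (p : C) : Prop :=
  exists e : C, 0 < e /\ forall z, `|z - p| < e -> K z.

Definition closure_point (C : numClosedFieldType) (K : C -> Prop) (p : C) : Prop :=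
  forall e : C, 0 < e -> exists z, K z /\ `|z - p| < e.

Definition boundary_point (C : numClosedFieldType) (K : C -> Prop) (p : C) : Prop :=
  closure_point K p /\ ~ interior_point K p.

(* the boundary of the (convex) set K is differentiable at p:
   K has a unique supporting (tangent) line at p *)
Definition smooth_boundary_at (C : numClosedFieldType) (K : C -> Prop) (p : C)
  : Prop :=
  boundary_point K p /\
  (exists L, supporting_line_at K L p) /\
  (forall L1 L2, supporting_line_at K L1 p -> supporting_line_at K L2 p -> forall z, L1 z <-> L2 z).

(* index tuples (j_s) on the support of c: j injective on {i | c i != 0} *)
Definition valid_idx (C : numClosedFieldType) (n : nat) (c : 'I_n -> C)
  (j : 'I_n -> 'I_n) : Prop :=
  forall i1 i2, c i1 != 0 -> c i2 != 0 -> j i1 = j i2 -> i1 = i2.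

(* v is a c-value of M *)
Definition c_value (C : numClosedFieldType) (n : nat) (M : 'M[C]_n) (c : 'I_n -> C)
  (v : C) : Prop :=
  exists j : 'I_n -> 'I_n, valid_idx c j /\
    v = \sum_(i < n | c i != 0) c i * eig M (j i).

(* the linear form sum_s c_{i_s} X_{j_s}, as its coefficient vector *)
Definition lform (C : numClosedFieldType) (n : nat) (c : 'I_n -> C)
  (j : {ffun 'I_n -> 'I_n}) : {ffun 'I_n -> C} :=
  [ffun k => \sum_(i < n | (c i != 0) && (j i == k)) c i].

Definition valid_idxb (C : numClosedFieldType) (n : nat) (c : 'I_n -> C)
  (j : {ffun 'I_n -> 'I_n}) : bool :=
  [forall i1, forall i2, ((c i1 != 0) && (c i2 != 0) && (j i1 == j i2)) ==> (i1 == i2)].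

(* a set F of representatives of the formal equivalence classes *)
Definition forms (C : numClosedFieldType) (n : nat) (c : 'I_n -> C)
  : seq {ffun 'I_n -> C} :=
  undup [seq lform c j | j <- enum [pred j | valid_idxb c j]].

(* deg(M;c) = |F| *)
Definition degc (C : numClosedFieldType) (n : nat) (c : 'I_n -> C) : nat :=
  size (forms c).

(* p(M;c)(t) *)
Definition pc (C : numClosedFieldType) (n : nat) (M : 'M[C]_n) (c : 'I_n -> C)
  : {poly C} :=
  \prod_(F <- forms c) ('X - (\sum_(k < n) F k * eig M k)%:P).

(* C[x,y,t] is represented as {poly {poly {poly C}}}: outer variable t,
   middle variable y, inner variable x. Evaluation at x, y: *)
Definition eval_xy (C : numClosedFieldType) (x y : C) (q : {poly {poly C}}) : C :=
  (map_poly (fun a : {poly C} => a.[x]) q).[y].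

(* R = r(A;c), i.e. R(x,y,t) = p(xA + yA^*;c)(t) for all x, y *)
Definition is_rpoly (C : numClosedFieldType) (n : nat) (A : 'M[C]_n) (c : 'I_n -> C)
  (R : {poly {poly {poly C}}}) : Prop :=
  forall x y : C, map_poly (eval_xy x y) R = pc (x *: A + y *: adjmx A) c.

(* irreducible element of an integral domain *)
Definition irreducible_elt (R : idomainType) (r : R) : Prop :=
  r != 0 /\ r \isn't a GRing.unit /\
  forall p q : R, r = p * q -> p \is a GRing.unit \/ q \is a GRing.unit.

(* r(A;c) is irreducible in C[x,y,t] *)
Definition r_irreducible (C : numClosedFieldType) (n : nat) (A : 'M[C]_n)
  (c : 'I_n -> C) : Prop :=
  exists R : {poly {poly {poly C}}}, is_rpoly A c R /\ irreducible_elt R.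

(* Main.v *)
(* For |u| = 1 put f_A(u) = sum_j c_j lambda_j(H_u(A)), a root of p(H_u(A);c).  If the
   line Re(u z) = t supports W(A;c) under (1), then t = f_A(u): when W(A;c) = W_c(A) the
   spectral theorem gives a point of W_c(A) on Re(u z) = f_A(u); in the smooth case the
   boundary point p satisfies f_A(u0) = Re(u0 p) for some u0 (minima over the circle are
   attained), and uniqueness of the tangent forces u0 = u.  Since
   A + ubar^2 A^* = 2 ubar H_u(A), each common supporting line yields a common zero
   (y, w) = (ubar^2, 2 ubar t) of the plane curves p(A + y A^*;c)(w) = 0 and
   p(B + y B^*;d)(w) = 0, of degrees deg(A;c) and deg(B;d), and distinct lines give
   distinct zeros.  By Bezout and Gauss the two polynomials, monic in w, share a factor
   G(y, w) of positive degree in w; a root of G(0, w) is both a c-value of A and a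
   d-value of B.  If r(A;c) is irreducible, the cofactor of G is a unit. *)
Require Import Defs.
From HB Require Import structures.
From mathcomp Require Import all_boot all_order all_algebra perm.
From mathcomp Require Import sesquilinear spectral.
From mathcomp Require Import mpoly.
From mathcomp Require Import zify ring.
Set Implicit Arguments. Unset Strict Implicit. Unset Printing Implicit Defensive.
Import Order.TTheory GRing.Theory Num.Theory.
Local Open Scope ring_scope.

(** * Bezout's theorem *)

(** Along any permutation [s] the degree bounds [a i - b (s i)] add up to the same total, so every
    nonzero Leibniz term obeys it. *)
Lemma size_det_weight_leq (R : idomainType) (N : nat) (M : 'M[{poly R}]_N)
    (a b : 'I_N -> nat) :
  (forall i j, M i j != 0 -> (size (M i j) + b j <= (a i).+1)%N) ->
  (size (\det M) <= (\sum_i a i).+1 - \sum_i b i)%N.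
Proof.
move=> hM; apply: leq_trans (size_sum _ _ _) _; apply/bigmax_leqP => s _.
rewrite mulr_sign; set t := \prod_i _.
have -> : size (if odd_perm s then - t else t) = size t.
  by case: ifP => _; rewrite ?size_polyN.
have [->|nz_t] := eqVneq t 0; first by rewrite size_poly0.
have nzM i : M i (s i) != 0.
  by move: nz_t; rewrite /t; apply: contraNneq => M0; rewrite (bigD1 i) //= M0 mul0r.
have : (\sum_i (size (M i (s i)) + b (s i)) <= \sum_i (a i + 1))%N.
  by apply: leq_sum => i _; rewrite addn1 hM.
rewrite !big_split /= sum1_card.
rewrite [(\sum_i b i)%N](reindex_inj (@perm_inj _ s)) /=.
rewrite /t size_prod // !cardT !size_enum_ord /=.
move: (bigop _ _ _) (bigop _ _ _) (bigop _ _ _) => x y z; lia.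
Qed.


(* Total degree at most [d]: the outer variable [w] and the inner variable [y]
   both have weight 1. *)
Definition wdeg (R : nzRingType) (d : nat) (P : {poly {poly R}}) : Prop :=
  forall i, P`_i != 0 -> (size (P`_i)%R + i <= d.+1)%N.

Lemma size_resultant_leq (R : idomainType) (P Q : {poly {poly R}}) (D E : nat) :
    size P = D.+1 -> size Q = E.+1 -> wdeg D P -> wdeg E Q ->
  (size (resultant P Q) <= (D * E).+1)%N.
Proof.
move=> sP sQ wP wQ; rewrite /resultant.
(* The coefficient of [P] of index [j - k] has degree at most [(D + k) - j], and likewise for [Q].
   So the row weights are [D + k] and [E + k], the column weight is [j], and the difference of the
   sums is [D * E]. *)
have -> : (D * E).+1 =
   ((\sum_(i < (size Q).-1 + (size P).-1)
       match split i with inl k => D + k | inr k => E + k end).+1 -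
    \sum_(i < (size Q).-1 + (size P).-1) i)%N.
  rewrite !big_split_ord /=.
  under eq_bigr => i _ do rewrite (unsplitK (inl i)).
  under [X in (_ + X).+1]eq_bigr => i _ do rewrite (unsplitK (inr i)).
  rewrite !sP !sQ /= [in LHS](_ : D * E = \sum_(i < E) D)%N; last first.
    by rewrite sum_nat_const card_ord mulnC.
  rewrite [X in ((X + _).+1 - _)%N]big_split /=; lia.
apply: size_det_weight_leq => i j; rewrite Sylvester_mxE.
case: (split i) => k; case: (leqP k j) => kj; rewrite ?mulr0n ?eqxx // mulr1n;
  rewrite -addSn -[X in (_ + X <= _)%N](subnK kj) addnA leq_add2r;
  [exact: wP | exact: wQ].
Qed.

(** Row operations over [F] that kill the rows beyond the rank of the matrix at [a] make these rows
    of [M] divisible by ['X - a%:P]; each of them contributes one factor to the determinant. *)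
Lemma dvdp_det_corank (F : fieldType) (N : nat) (M : 'M[{poly F}]_N) (a : F) :
  ('X - a%:P) ^+ (N - \rank (map_mx (horner_eval a) M)) %| \det M.
Proof.
set M0 := map_mx _ M; set r := \rank M0.
pose L := invmx (col_ebase M0).
have LM0 (i : 'I_N) j : (r <= i)%N -> (L *m M0) i j = 0.
  rewrite -(mulmx_ebase M0) -/r /L !mulmxA mulVmx ?col_ebase_unit //.
  rewrite mul1mx mxE => ri; rewrite big1 // => k _.
  by rewrite mxE ltnNge ri andbF mul0r.
pose LM := map_mx polyC L *m M.
have dLM : \det LM = (\det L)%:P * \det M by rewrite det_mulmx det_map_mx.
have dL : \det L != 0 by rewrite -unitfE -unitmxE unitmx_inv col_ebase_unit.
have evLM : map_mx (horner_eval a) LM = L *m M0.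
  rewrite map_mxM -map_mx_comp map_mx_id // => x.
  by rewrite /= /horner_eval hornerC.
pose dg (i : 'I_N) : {poly F} := if (i < r)%N then 1 else 'X - a%:P.
have LME : LM = diag_mx (\row_i dg i) *m (\matrix_(i, j) (LM i j %/ dg i)).
  apply/matrixP => i j; rewrite mul_diag_mx !mxE /dg.
  case: ltnP => ri; first by rewrite divp1 mul1r.
  rewrite mulrC divpK // dvdp_XsubCl.
  by have /matrixP/(_ i j) := evLM; rewrite LM0 // !mxE => /eqP.
have : ('X - a%:P) ^+ (N - r) %| \det LM.
  rewrite LME det_mulmx det_diag; apply: dvdp_mulr.
  have rN : (r <= N)%N by exact: rank_leq_row.
  rewrite (eq_bigr dg) => [|i _]; last by rewrite mxE.
  rewrite (bigID (fun i : 'I_N => (i < r)%N)) /= dvdp_mull //.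
  rewrite (eq_bigr (fun=> 'X - a%:P)) => [|i]; last by rewrite /dg => /negbTE->.
  rewrite prodr_const dvdp_exp2l //.
  rewrite (eq_card (B := [predC [pred i : 'I_N | (i < r)%N]])) //.
  rewrite -(leq_add2l #|[pred i : 'I_N | (i < r)%N]|) cardC card_ord.
  have -> : #|[pred i : 'I_N | (i < r)%N]| = r.
    by rewrite -sum1_card -(big_ord_widen N (fun=> 1%N)) // sum1_card card_ord.
  by rewrite subnKC.
by rewrite dLM mul_polyC dvdpZr.
Qed.

(** The first [j] rows form a square Vandermonde matrix with distinct nodes. *)
Lemma mxrank_Vandermonde (F : fieldType) (N j : nat) (w : 'rV[F]_j) :
  (j <= N)%N -> injective (w 0) -> \rank (Vandermonde N w) = j.
Proof.
move=> jN w_inj; apply/eqP; rewrite eqn_leq rank_leq_col /=.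
have VE : Vandermonde j w = rowsub (widen_ord jN) (Vandermonde N w).
  by apply/matrixP => a b; rewrite !mxE.
rewrite -[X in (X <= _)%N](@mxrank_unit _ _ (Vandermonde j w)).
  by rewrite VE mxrankS // rowsub_sub.
rewrite unitmxE det_Vandermonde unitfE prodf_seq_neq0.
apply/allP => a _; rewrite /= prodf_seq_neq0; apply/allP => b _ /=.
by apply/implyP => ab; rewrite subr_eq0 (inj_eq w_inj) -val_eqE gtn_eqF.
Qed.

(** Unlike [max_poly_roots] this counts repetitions, since several intersection points may lie over
    one abscissa. Over a closed field [s] is a sub-multiset of the full list of roots. *)
Lemma ltn_size_count_mup (F : closedFieldType) (p : {poly F}) (s : seq F) :
  p != 0 -> (forall x, (count_mem x s <= mup x p)%N) -> (size s < size p)%N.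
Proof.
move=> nz_p hs; have [r pE] := closed_field_poly_normal p.
have lc0 : lead_coef p != 0 by rewrite lead_coef_eq0.
have mupE x : mup x p = count_mem x r.
  rewrite pE -mul_polyC mupMr ?mu_prod_XsubC //.
  by rewrite rootE hornerC.
have -> : size p = (size r).+1 by rewrite pE size_scale // size_prod_XsubC.
rewrite ltnS.
have /count_subseqP[t ts st] : forall x, (count_mem x s <= count_mem x r)%N.
  by move=> x; rewrite -mupE.
by rewrite (perm_size st) size_subseq.
Qed.

(* Specialization of the inner variable [y] of [R[y][w]]. *)
Definition ev (R : comNzRingType) (y : R) : {poly {poly R}} -> {poly R} :=
  map_poly (horner_eval y).

HB.instance Definition _ (R : comNzRingType) (y : R) :=
  GRing.RMorphism.copy (ev y) (map_poly (horner_eval y)).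

Lemma coef_ev (R : comNzRingType) (y : R) (P : {poly {poly R}}) i :
  (ev y P)`_i = (P`_i).[y].
Proof. by rewrite /ev coef_map. Qed.

Lemma evC (R : comNzRingType) (y : R) (p : {poly R}) : ev y p%:P = p.[y]%:P.
Proof. by rewrite /ev map_polyC. Qed.

Lemma size_ev_monic (R : comNzRingType) (y : R) (P : {poly {poly R}}) :
  P \is monic -> size (ev y P) = size P.
Proof.
move=> /eqP mP; apply: size_map_poly_id0.
by rewrite mP /horner_eval hornerC oner_neq0.
Qed.

(** Each row of the Sylvester matrix holds the coefficients of [P] or [Q] times a power of [w], so
    it annihilates the column of powers of a common root. *)
Lemma mulmx_Sylvester_Vandermonde (F : fieldType) (P Q : {poly {poly F}}) (y : F)
    (j : nat) (w : 'rV[F]_j) :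
    (forall i, root (ev y P) (w 0 i)) -> (forall i, root (ev y Q) (w 0 i)) ->
  map_mx (horner_eval y) (Sylvester_mx P Q) *m Vandermonde _ w = 0.
Proof.
move=> hP hQ; apply/matrixP => i l; rewrite mxE [RHS]mxE.
have aux (T : {poly {poly F}}) (n k : nat) : root (ev y T) (w 0 l) ->
    ((size T).-1 + k < n)%N ->
  \sum_(m < n) horner_eval y (T`_(m - k) *+ (k <= m)) * w 0 l ^+ m = 0.
  move=> /rootP hT kn.
  transitivity ((ev y T * 'X^k).[w 0 l]); last by rewrite hornerM hT mul0r.
  rewrite (@horner_coef_wide _ n).
    apply: eq_bigr => m _; rewrite coefMXn ltnNge.
    by case: leqP => _; rewrite /= /horner_eval ?coef_ev ?mulr1n // mulr0n horner0.
  apply: leq_trans (size_polyMleq _ _) _; rewrite size_polyXn addnS /=.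
  apply: leq_trans kn; rewrite -addSn leq_add2r.
  exact: leq_trans (size_poly _ _) (leqSpred _).
rewrite (eq_bigr (fun m : 'I__ => horner_eval y (match split i with
    | inl k => P`_(m - k) *+ (k <= m) | inr k => Q`_(m - k) *+ (k <= m)
    end) * w 0 l ^+ m)) => [|m _]; last first.
  by rewrite mxE [Vandermonde _ _ _ _]mxE Sylvester_mxE.
by case: (split i) => k; apply: aux => //; rewrite ?ltn_add2l // addnC ltn_add2r.
Qed.

(* [j] common roots over [y0] span a [j]-dimensional kernel of the Sylvester matrix
   at [y0], hence [y0] is a root of the resultant of multiplicity at least [j]. *)
Lemma bezout_gcdp (F : closedFieldType) (P Q : {poly {poly F}}) (D E k : nat)
    (pt : 'I_k -> F * F) :
    P \is monic -> Q \is monic -> size P = D.+1 -> size Q = E.+1 ->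
    wdeg D P -> wdeg E Q -> injective pt ->
    (forall i, root (ev (pt i).1 P) (pt i).2) ->
    (forall i, root (ev (pt i).1 Q) (pt i).2) ->
    (D * E < k)%N ->
  (1 < size (gcdp P Q))%N.
Proof.
move=> mP mQ sP sQ wP wQ pt_inj rP rQ DEk; rewrite -resultant_eq0.
apply: contraTT DEk => nz; rewrite -leqNgt.
rewrite -ltnS; apply: leq_trans (size_resultant_leq sP sQ wP wQ).
have -> : k = size [seq (pt i).1 | i <- enum 'I_k].
  by rewrite size_map size_enum_ord.
apply: ltn_size_count_mup => // y.
rewrite mup_geq //.
(* The points over [y]; their second coordinates are the Vandermonde nodes. *)
pose s := [seq i <- enum 'I_k | (pt i).1 == y].
have -> : count_mem y [seq (pt i).1 | i <- enum 'I_k] = size s.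
  by rewrite count_map -size_filter.
pose t := in_tuple s.
pose w : 'rV[F]_(size s) := \row_i (pt (tnth t i)).2.
have tP i : (pt (tnth t i)).1 = y.
  by have := mem_tnth i t; rewrite mem_filter => /andP[/eqP].
have w_inj : injective (w 0).
  move=> a b; rewrite !mxE => ab.
  have /tuple_uniqP t_inj : uniq t by exact: filter_uniq (enum_uniq _).
  apply/t_inj/pt_inj; move: ab (tP a) (tP b).
  by case: (pt _) (pt _) => [? ?] [? ?] /= -> -> ->.
have rwP i : root (ev y P) (w 0 i) by rewrite mxE -(tP i).
have rwQ i : root (ev y Q) (w 0 i) by rewrite mxE -(tP i).
have MV := mulmx_Sylvester_Vandermonde rwP rwQ.
apply: dvdp_trans (dvdp_det_corank (Sylvester_mx P Q) y); apply: dvdp_exp2l.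
(* [ev y P] has degree [D], so at most [D] points lie over [y], and the Vandermonde matrix has
   enough rows for full column rank. *)
have sD : (size s <= D)%N.
  have := @max_poly_roots _ (ev y P) [seq (pt i).2 | i <- s].
  rewrite size_map size_ev_monic // sP ltnS; apply.
  - by rewrite -size_poly_eq0 size_ev_monic // sP.
  - apply/allP => x /mapP[i]; rewrite mem_filter => /andP[/eqP <- _] ->.
    exact: rP.
  rewrite map_inj_in_uniq; first exact: filter_uniq (enum_uniq _).
  move=> a b.
  rewrite !mem_filter => /andP[/eqP ay _] /andP[/eqP by_ _] ab.
  apply: pt_inj; move: ab ay by_.
  by case: (pt _) (pt _) => [? ?] [? ?] /= -> -> ->.
have := mulmx0_rank_max MV; rewrite mxrank_Vandermonde //.
  by move=> h; rewrite leq_subRL // ?rank_leq_row.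
by apply: leq_trans sD _; rewrite sP leq_addl.
Qed.

(** A generator of the kernel of a morphism into an integral domain is prime. This serves twice: for
    linear polynomials in [y] in Gauss's lemma, and for the variable [x] in the homogenization. *)
Lemma prime_strip (T T' : idomainType) (f : {rmorphism T -> T'}) (a P Q R : T) :
    (forall p, f p = 0 -> exists p', p = a * p') -> f a = 0 -> a != 0 ->
    P * Q = a * R ->
  (exists2 P', P = a * P' & P' * Q = R) \/ (exists2 Q', Q = a * Q' & P * Q' = R).
Proof.
move=> kerf fa nz_a PQ.
have /eqP : f P * f Q = 0 by rewrite -rmorphM PQ rmorphM fa mul0r.
rewrite mulf_eq0 => /orP[] /eqP /kerf[T1 eT]; [left | right]; exists T1 => //;
  by apply: (mulfI nz_a); rewrite -PQ eT; ring.
Qed.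

Lemma prime_strip_exp (T T' : idomainType) (f : {rmorphism T -> T'}) (a R : T) :
    (forall p, f p = 0 -> exists p', p = a * p') -> f a = 0 -> a != 0 ->
    forall (k : nat) (P Q : T), P * Q = a ^+ k * R ->
  exists i j P' Q', [/\ P = a ^+ i * P', Q = a ^+ j * Q' & P' * Q' = R].
Proof.
move=> kerf fa nz_a; elim=> [|k IHk] P Q PQ.
  by exists 0%N, 0%N, P, Q; rewrite !expr0 !mul1r in PQ *.
rewrite exprS -mulrA in PQ.
case: (prime_strip kerf fa nz_a PQ) => [] [T1 ->] /IHk [i] [j] [P'] [Q'] [-> -> ?].
  by exists i.+1, j, P', Q'; rewrite exprS mulrA.
by exists i, j.+1, P', Q'; rewrite exprS mulrA.
Qed.

Lemma ev_eq0 (F : fieldType) (y : F) (P : {poly {poly F}}) :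
  ev y P = 0 -> exists P', P = ('X - y%:P)%:P * P'.
Proof.
move=> P0; exists (map_poly (fun p => p %/ ('X - y%:P)) P).
apply/polyP => i; rewrite coefCM coef_map_id0 ?div0p // mulrC divpK //.
by rewrite dvdp_XsubCl rootE -coef_ev P0 coef0.
Qed.

(* Gauss's lemma: over an algebraically closed field the primes of [F[y]] are linear,
   so they can be removed from [e] one root at a time by evaluation. *)
Lemma gauss_split (F : closedFieldType) (e : {poly F}) (P Q R : {poly {poly F}}) :
    e != 0 -> P * Q = e%:P * R ->
  exists e1 e2 P' Q', [/\ P = e1%:P * P', Q = e2%:P * Q', P' * Q' = R & e1 * e2 = e].
Proof.
have [n] := ubnP (size e); elim: n e P Q => // n IHn e P Q sze nz_e PQ.
have [sz1|sz1] := leqP (size e) 1.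
  (* A nonzero constant is a unit and goes entirely into the second factor. *)
  have [c eE] : exists c, e = c%:P by exists e`_0; apply: size1_polyC.
  exists 1, e, P, (e^-1%:P * Q).
  have ue : e \is a GRing.unit.
    rewrite poly_unitE eE size_polyC coefC /= unitfE.
    by move: nz_e; rewrite eE polyC_eq0 => ->.
  split; rewrite ?mul1r //; first by rewrite mulrA -polyCM divrr // mul1r.
  by rewrite mulrCA PQ mulrA -polyCM mulVr // mul1r.
have /closed_rootP [y] : size e != 1%N by rewrite gtn_eqF.
rewrite -dvdp_XsubCl => /dvdpP[e' eE].
have nz_e' : e' != 0 by apply: contraNneq nz_e => e'0; rewrite eE e'0 mul0r.
have sze' : (size e' < n)%N.
  by move: sze; rewrite eE size_Mmonic ?monicXsubC // size_XsubC addn2.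
have nz_a : ('X - y%:P)%:P != 0 :> {poly {poly F}}.
  by rewrite polyC_eq0 polyXsubC_eq0.
have eva : ev y ('X - y%:P)%:P = 0 by rewrite evC !hornerE subrr.
rewrite eE polyCM -mulrA mulrCA in PQ.
have [[T1 PE TQ]|[T1 QE TQ]] := prime_strip (@ev_eq0 _ y) eva nz_a PQ.
  have [e1 [e2 [P' [Q' [T1E QE PQE ee]]]]] := IHn _ _ _ sze' nz_e' TQ.
  exists (e1 * ('X - y%:P)), e2, P', Q'; split => //; last by rewrite eE -ee; ring.
  by rewrite PE T1E polyCM; ring.
have [e1 [e2 [P' [Q' [PE T1E PQE ee]]]]] := IHn _ _ _ sze' nz_e' TQ.
exists e1, (e2 * ('X - y%:P)), P', Q'; split => //; last by rewrite eE -ee; ring.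
by rewrite QE T1E polyCM; ring.
Qed.

(** [gcdp] divides [P] and [Q] only up to nonzero factors in [y]. Gauss's lemma is applied twice: it
    cuts the gcd down to a true divisor of [P], then that one to a true divisor of [Q]. Only
    polynomials in [y] are removed, so the degree in [w] is kept. *)
Lemma gcdp_common_factor (F : closedFieldType) (P Q : {poly {poly F}}) :
    (1 < size (gcdp P Q))%N ->
  exists G H H', [/\ P = G * H, Q = G * H' & (1 < size G)%N].
Proof.
set G0 := gcdp P Q => szG.
have /Pdiv.Idomain.dvdpP[[c Q0] /= nz_c PE] : G0 %| P by exact: dvdp_gcdl.
have /Pdiv.Idomain.dvdpP[[d Q1] /= nz_d QE] : G0 %| Q by exact: dvdp_gcdr.
rewrite -mul_polyC in PE; rewrite -mul_polyC in QE.
have [e1 [e2 [H1 [G1 [_ G0E PQ1 ee1]]]]] := gauss_split nz_c (esym PE).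
have QE' : Q1 * e2%:P * G1 = d%:P * Q by rewrite -mulrA -G0E.
have [e3 [e4 [H2 [G2 [_ G1E PQ2 ee2]]]]] := gauss_split nz_d QE'.
exists G2, (H1 * e4%:P), H2; split; first by rewrite -PQ1 G1E; ring.
  by rewrite -PQ2 mulrC.
move: szG; rewrite G0E G1E !size_Cmul //.
  by apply: contraNneq nz_d => e40; rewrite -ee2 e40 mulr0.
by apply: contraNneq nz_c => e20; rewrite -ee1 e20 mulr0.
Qed.

Lemma monic_factor_lead (F : fieldType) (P G H : {poly {poly F}}) :
  P \is monic -> P = G * H -> lead_coef G * lead_coef H = 1.
Proof. by move=> /eqP mP PE; rewrite -lead_coefM -PE. Qed.

(** The leading coefficients of two factors of a monic polynomial are inverse to each other, so they
    vanish at no [y]. *)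
Lemma size_ev_factor (F : fieldType) (y : F) (P G H : {poly {poly F}}) :
  P \is monic -> P = G * H -> size (ev y G) = size G.
Proof.
move=> mP /(monic_factor_lead mP) lGH; apply: size_map_poly_id0.
have /eqP : (lead_coef G).[y] * (lead_coef H).[y] = 1 by rewrite -hornerM lGH hornerC.
by rewrite /horner_eval; apply: contraTneq => ->; rewrite mul0r eq_sym oner_eq0.
Qed.

(** * The polynomial r(A;c) *)

Lemma polyP_horner (R : numDomainType) (p q : {poly R}) :
  (forall x, p.[x] = q.[x]) -> p = q.
Proof.
move=> pq; apply/eqP; rewrite -subr_eq0; apply: contraT => nz.
have := @max_poly_roots _ (p - q) [seq i%:R | i <- iota 0 (size (p - q))] nz.
rewrite size_map size_iota ltnn => -> //.
  by apply/allP => x _; rewrite rootE hornerD hornerN pq subrr.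
by rewrite map_inj_uniq ?iota_uniq //; exact: mulrIn (oner_neq0 _).
Qed.

Lemma char_polyE_eigs (C : numClosedFieldType) (n : nat) (M : 'M[C]_n) :
  char_poly M = \prod_(z <- eigs M) ('X - z%:P).
Proof.
rewrite /eigs; case: closed_field_poly_normal => /= r {1}->.
by rewrite (monicP (char_poly_monic M)) scale1r.
Qed.

Lemma size_eigs (C : numClosedFieldType) (n : nat) (M : 'M[C]_n) : size (eigs M) = n.
Proof.
by have := size_char_poly M; rewrite char_polyE_eigs size_prod_XsubC => -[].
Qed.

Lemma horner_char_poly (R : comNzRingType) (n : nat) (M : 'M[R]_n) (t : R) :
  (char_poly M).[t] = \det (t%:M - M).
Proof.
rewrite /char_poly -/(horner_eval t _) -det_map_mx; congr (\det _).
apply/matrixP => i j; rewrite !mxE /= /horner_eval hornerD hornerN hornerC.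
by rewrite hornerMn hornerX.
Qed.

Lemma eigs_scale (C : numClosedFieldType) (n : nat) (M : 'M[C]_n) (s : C) :
  s != 0 -> perm_eq (eigs (s *: M)) [seq s * z | z <- eigs M].
Proof.
move=> nz_s; apply: prod_XsubC_eq; rewrite -char_polyE_eigs big_map.
apply: polyP_horner => x.
have -> : x = s * (s^-1 * x) by rewrite mulVKf.
move: (s^-1 * x) => {}x.
rewrite horner_char_poly -scale_scalar_mx -scalerBr detZ -horner_char_poly.
rewrite char_polyE_eigs !horner_prod -[in s ^+ n](size_eigs M).
elim: (eigs M) => [|z r IHr]; first by rewrite !big_nil expr0 mulr1.
by rewrite /= !big_cons exprS -IHr !hornerXsubC; ring.
Qed.

Section Forms.
Variables (C : numClosedFieldType) (n : nat) (c : 'I_n -> C).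

Lemma mem_formsP (F : {ffun 'I_n -> C}) :
  reflect (exists2 j, valid_idxb c j & F = lform c j) (F \in forms c).
Proof.
rewrite mem_undup; apply: (iffP mapP) => [[j]|[j vj ->]].
  by rewrite mem_enum => vj ->; exists j.
by exists j => //; rewrite mem_enum.
Qed.

Definition permF (s : 'S_n) (F : {ffun 'I_n -> C}) : {ffun 'I_n -> C} :=
  [ffun k => F (s k)].

Lemma permF_inj s : injective (permF s).
Proof.
move=> F G /ffunP FG; apply/ffunP => k.
by have := FG ((s^-1)%g k); rewrite !ffunE permKV.
Qed.

(** An injective map of a finite duplicate-free list into itself is a bijection. This makes [pcl]
    symmetric, hence independent of the enumeration of the eigenvalues. *)
Lemma permF_forms (s : 'S_n) : perm_eq [seq permF s F | F <- forms c] (forms c).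
Proof.
have uf : uniq (forms c) by exact: undup_uniq.
have um : uniq [seq permF s F | F <- forms c].
  by rewrite map_inj_uniq //; exact: permF_inj.
apply: uniq_perm => //.
apply: (uniq_min_size um _ _).2; last by rewrite size_map.
move=> _ /mapP[F /mem_formsP[j vj ->] ->]; apply/mem_formsP.
exists [ffun i => (s^-1)%g (j i)].
  apply/forallP => i1; apply/forallP => i2; rewrite !ffunE (inj_eq perm_inj).
  by have /forallP/(_ i1)/forallP/(_ i2) := vj.
apply/ffunP => k; rewrite !ffunE; apply: eq_bigl => i; rewrite ffunE.
by rewrite (canF_eq (permKV s)).
Qed.

(** An arbitrary vector replaces the eigenvalues, so that the sorted list behind [heig] and the
    unsorted one behind [eig] can be compared. *)
Definition pcl (l : 'I_n -> C) : {poly C} :=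
  \prod_(F <- forms c) ('X - (\sum_(k < n) F k * l k)%:P).

Lemma pcl_perm (l : 'I_n -> C) (s : 'S_n) : pcl (fun k => l (s k)) = pcl l.
Proof.
rewrite /pcl -[in LHS](perm_big _ (permF_forms s)) /= big_map.
apply: eq_bigr => F _; congr (_ - _%:P).
rewrite [RHS](reindex_inj (@perm_inj _ s)) /=.
by apply: eq_bigr => k _; rewrite ffunE.
Qed.

Lemma eq_pcl (l1 l2 : 'I_n -> C) : l1 =1 l2 -> pcl l1 = pcl l2.
Proof.
move=> l12; apply: eq_bigr => F _; congr (_ - _%:P).
by apply: eq_bigr => k _; rewrite l12.
Qed.

Lemma pcl_perm_eq (l1 l2 : seq C) : size l2 = n -> perm_eq l1 l2 ->
  pcl (fun k => nth 0 l1 k) = pcl (fun k => nth 0 l2 k).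
Proof.
move=> /eqP s2; rewrite -[l2]/(val (Tuple s2)) => /tuple_permP[s ->].
rewrite -[RHS](pcl_perm _ s); apply: eq_pcl => k.
by rewrite -!tnth_nth tnth_mktuple.
Qed.

Lemma pcE (M : 'M[C]_n) (l : seq C) : perm_eq l (eigs M) ->
  pc M c = pcl (fun k => nth 0 l k).
Proof. by move=> lM; rewrite (pcl_perm_eq (size_eigs M) lM). Qed.

Lemma sum_lform (j : {ffun 'I_n -> 'I_n}) (l : 'I_n -> C) :
  \sum_k lform c j k * l k = \sum_(i | c i != 0) c i * l (j i).
Proof.
rewrite [RHS](partition_big j xpredT) //=; apply: eq_bigr => k _.
rewrite ffunE mulr_suml; apply: eq_bigr => i /andP[_ /eqP ->] //.
Qed.

Lemma root_pclP (l : 'I_n -> C) (v : C) :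
  root (pcl l) v <-> exists j : 'I_n -> 'I_n, valid_idx c j /\
    v = \sum_(i < n | c i != 0) c i * l (j i).
Proof.
rewrite /pcl -(big_map (fun F : {ffun 'I_n -> C} => \sum_k F k * l k) xpredT
  (fun z => 'X - z%:P)) root_prod_XsubC; split.
  move=> /mapP[F /mem_formsP[j vj ->] ->]; exists j; split; last exact: sum_lform.
  move=> i1 i2 c1 c2 j12; have /forallP/(_ i1)/forallP/(_ i2) := vj.
  by rewrite c1 c2 j12 eqxx /= => /eqP.
move=> [j [vj ->]]; apply/mapP; exists (lform c [ffun i => j i]).
  apply/mem_formsP; exists [ffun i => j i] => //.
  apply/forallP => i1; apply/forallP => i2; rewrite !ffunE.
  by apply/implyP => /andP[/andP[c1 c2] /eqP/vj ->].
by rewrite sum_lform; apply: eq_bigr => i _; rewrite ffunE.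
Qed.

Lemma root_pcP (M : 'M[C]_n) (v : C) : root (pc M c) v <-> c_value M c v.
Proof. exact: root_pclP. Qed.

(** Homogeneity, used to pass from [Hth u A] to the pencil [A + y *: adjmx A] and to dehomogenize
    r(A;c). *)
Lemma pc_scale (M : 'M[C]_n) (s t : C) : s != 0 ->
  (pc (s *: M) c).[s * t] = s ^+ degc c * (pc M c).[t].
Proof.
move=> nz_s; have := eigs_scale M nz_s; rewrite perm_sym => /pcE ->.
rewrite /pc /pcl /degc !horner_prod; elim: (forms c) => [|F r IHr].
  by rewrite !big_nil expr0 mulr1.
rewrite /= !big_cons IHr exprS mulrACA; congr (_ * _).
rewrite !hornerXsubC mulrBr mulr_sumr; congr (_ - _); apply: eq_bigr => k _.
by rewrite (nth_map 0) ?size_eigs // /eig mulrCA.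
Qed.

Lemma monic_pcl (l : 'I_n -> C) : pcl l \is monic.
Proof. by rewrite monic_prod // => F _; rewrite monicXsubC. Qed.

Lemma size_pcl (l : 'I_n -> C) : size (pcl l) = (degc c).+1.
Proof.
by rewrite /pcl -(big_map (fun F : {ffun 'I_n -> C} => \sum_k F k * l k) xpredT
  (fun z => 'X - z%:P)) size_prod_XsubC size_map.
Qed.

(** The index tuple is the identity on the sorted eigenvalues; symmetry absorbs the sorting, and
    indices of zero weight add nothing. *)
Lemma heig_sum_root (H : 'M[C]_n) : root (pc H c) (\sum_(j < n) c j * heig H j).
Proof.
rewrite (@pcE H (sort (fun x y : C => 'Re y <= 'Re x) (eigs H))) ?perm_sort //.
apply/root_pclP; exists id; split => // .
rewrite [LHS](bigID (fun i => c i != 0)) /= [X in _ + X]big1 ?addr0 //.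
by move=> i; rewrite negbK => /eqP ->; rewrite mul0r.
Qed.

End Forms.

(** * Total degree in two variables *)

Section Wdeg.
Variable R : idomainType.
Implicit Types P Q : {poly {poly R}}.

Lemma wdeg0 d : wdeg d (0 : {poly {poly R}}).
Proof. by move=> i; rewrite coef0 eqxx. Qed.

Lemma wdeg_size d P i : wdeg d P -> (size (P`_i)%R <= d.+1 - i)%N.
Proof.
move=> wP; have [->|/wP] := eqVneq P`_i 0; first by rewrite size_poly0.
by move=> h; rewrite leq_subRL ?(leq_trans (leq_addl _ _) h) // addnC.
Qed.

Lemma wdegP d P : (forall i, (size (P`_i)%R <= d.+1 - i)%N) -> wdeg d P.
Proof.
move=> h i nz; have := h i.
have : (0 < size (P`_i)%R)%N by rewrite lt0n size_poly_eq0.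
case: (size _) => // k _; move: k; lia.
Qed.

Lemma wdegD d P Q : wdeg d P -> wdeg d Q -> wdeg d (P + Q).
Proof.
move=> wP wQ; apply: wdegP => i; rewrite coefD.
by apply: leq_trans (size_polyD _ _) _; rewrite geq_max !wdeg_size.
Qed.

Lemma wdegN d P : wdeg d P -> wdeg d (- P).
Proof. by move=> wP; apply: wdegP => i; rewrite coefN size_polyN wdeg_size. Qed.

Lemma wdegM d e P Q : wdeg d P -> wdeg e Q -> wdeg (d + e) (P * Q).
Proof.
move=> wP wQ; apply: wdegP => i; rewrite coefM.
apply: leq_trans (size_sum _ _ _) _; apply/bigmax_leqP => j _.
have [->|nz1] := eqVneq P`_j 0; first by rewrite mul0r size_poly0.
have [->|nz2] := eqVneq Q`_(i - j) 0; first by rewrite mulr0 size_poly0.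
apply: leq_trans (size_polyMleq _ _) _.
have aux (a b j' i' : nat) : (a + j' <= d.+1 -> b + (i' - j') <= e.+1 -> j' <= i' ->
  (a + b).-1 <= (d + e).+1 - i')%N by lia.
exact: aux (wP _ nz1) (wQ _ nz2) (ltn_ord j).
Qed.

Lemma wdeg_prod (I : Type) (r : seq I) (F : I -> {poly {poly R}}) :
  (forall i, wdeg 1 (F i)) -> wdeg (size r) (\prod_(i <- r) F i).
Proof.
move=> wF; elim: r => [|i r IHr]; last by rewrite big_cons; apply: (wdegM (wF i) IHr).
rewrite big_nil; apply: wdegP => -[|i]; rewrite coef1 ?size_poly1 // size_poly0 //.
Qed.

Lemma wdeg_det n (M : 'M[{poly {poly R}}]_n) :
  (forall i j, wdeg 1 (M i j)) -> wdeg n (\det M).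
Proof.
move=> wM; rewrite /determinant.
elim/big_rec: _ => [|s P _ wP]; first exact: wdeg0.
apply: wdegD => //; rewrite mulr_sign.
have w : wdeg n (\prod_i M i (s i)).
  have := @wdeg_prod _ (index_enum 'I_n) _ (fun i => wM i (s i)).
  by rewrite -[index_enum _]enumT size_enum_ord.
by case: (odd_perm s) => //; apply: wdegN.
Qed.

Lemma wdeg_char_poly n (A0 A1 : 'M[R]_n) :
  wdeg n (char_poly (map_mx polyC A0 + 'X *: map_mx polyC A1)).
Proof.
apply: wdeg_det => i j; rewrite !mxE; apply: wdegD.
  case: (i == j); rewrite ?mulr1n ?mulr0n; last exact: wdeg0.
  by apply: wdegP => -[|[|k]]; rewrite coefX /= ?size_poly0 ?size_poly1.
apply/wdegN/wdegP => -[|k]; rewrite coefC /= ?size_poly0 //.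
apply: leq_trans (size_polyD _ _) _; rewrite geq_max (leq_trans (size_polyC_leq1 _)) //=.
rewrite mulrC; apply: leq_trans (size_polyMleq _ _) _; rewrite size_polyX.
by have := size_polyC_leq1 (A1 i j); case: (size _) => [|[]].
Qed.

End Wdeg.

Section RPoly.
Variables (C : numClosedFieldType) (n : nat) (c : 'I_n -> C).

Definition lfm (F : {ffun 'I_n -> C}) : {mpoly C[n]} := \sum_(k < n) F k *: 'X_k.

(** [pcl] with indeterminates for eigenvalues; its coefficients are symmetric polynomials, to which
    the fundamental theorem applies. *)
Definition formsP : {poly {mpoly C[n]}} := \prod_(F <- forms c) ('X - (lfm F)%:P).

Lemma map_formsP (l : 'I_n -> C) : map_poly (meval l) formsP = pcl c l.
Proof.
rewrite /formsP rmorph_prod /=; apply: eq_bigr => F _.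
rewrite rmorphB /= map_polyX map_polyC /=; congr (_ - _%:P).
by rewrite /lfm raddf_sum /=; apply: eq_bigr => k _; rewrite mevalZ mevalXU.
Qed.

Lemma formsP_sym i : formsP`_i \is symmetric.
Proof.
apply/issymP => s.
rewrite -coef_map; congr (_ `_ i).
rewrite /formsP rmorph_prod /= -[in RHS](perm_big _ (permF_forms c (s^-1)%g)) /= big_map.
under eq_bigr => F _.
  rewrite rmorphB /= map_polyX map_polyC /=.
  have -> : msym s (lfm F) = lfm (permF (s^-1)%g F).
    rewrite /lfm raddf_sum /= [RHS](reindex_inj (@perm_inj _ s)) /=.
    apply: eq_bigr => k _; rewrite msymZ ffunE permK; congr (_ *: _).
    by rewrite /msym mmapX mmap1U.
  over.
by [].
Qed.

Lemma msize_formsP i : (msize (formsP`_i)%R <= (degc c).+1 - i)%N.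
Proof.
rewrite /formsP /degc; elim: (forms c) i => [|F r IHr] i /=.
  rewrite big_nil coef1; case: i => [|i] /=; first by rewrite mmeasure1.
  by rewrite mmeasure0.
rewrite big_cons mulrBl coefB coefXM coefCM.
apply: leq_trans (msizeD_le _ _) _; rewrite geq_max mmeasureN; apply/andP; split.
  by case: i => [|i] /=; rewrite ?mmeasure0 // subSS.
have [->|nz] := eqVneq (lfm F * (\prod_(j <- r) ('X - (lfm j)%:P))`_i) 0.
  by rewrite mmeasure0.
move: nz; rewrite mulf_eq0 negb_or => /andP[nz1 nz2].
rewrite msizeM //.
have h1 : (msize (lfm F) <= 2)%N.
  apply: leq_trans (mmeasure_sum _ _ _ _) _; apply/bigmax_leqP_seq => k _ _.
  by apply: leq_trans (msizeZ_le _ _) _; rewrite msizeX mdeg1.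
have h2 : (0 < msize (\prod_(j <- r) ('X - (lfm j)%:P))%R`_i)%N.
  by rewrite lt0n mmeasure_poly_eq0.
have aux (a b s : nat) : (a <= 2 -> 0 < b -> b <= s.+1 - i ->
  (a + b).-1 <= s.+2 - i)%N by lia.
exact: aux h1 h2 (IHr i).
Qed.

Variables (A0 A1 : 'M[C]_n).

Let cp := char_poly (map_mx polyC A0 + 'X *: map_mx polyC A1).

(* The elementary symmetric functions of the eigenvalues of [A0 + y A1]; the one of
   degree [k.+1] has degree at most [k.+1] in [y]. *)
Let es (k : 'I_n) : {poly C} := (-1) ^+ k.+1 * cp`_(n - k.+1).

Lemma size_es k : (size (es k) <= k.+2)%N.
Proof.
rewrite /es.
have -> : (-1) ^+ k.+1 = ((-1) ^+ k.+1)%:P :> {poly C} by rewrite rmorphXn /= polyCN.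
rewrite mul_polyC size_scale ?signr_eq0 //.
apply: leq_trans (@wdeg_size _ n cp (n - k.+1) (@wdeg_char_poly _ _ A0 A1)) _.
by have := ltn_ord k; move: (nat_of_ord k) => a; lia.
Qed.

Lemma ev_cp y : ev y cp = char_poly (A0 + y *: A1).
Proof.
rewrite /ev map_char_poly; congr char_poly; apply/matrixP => i j.
by rewrite !mxE /= /horner_eval !hornerE.
Qed.

Lemma horner_es y k : (es k).[y] =
  (mesym n C k.+1).@[eig (A0 + y *: A1)].
Proof.
set M := A0 + y *: A1.
have -> : (es k).[y] = (-1) ^+ k.+1 * (char_poly M)`_(n - k.+1).
  rewrite -ev_cp coef_ev /es hornerM; congr (_ * _).
  by rewrite -polyC1 -polyCN -rmorphXn hornerC.
have se : size (eigs M) == n by rewrite size_eigs.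
have lt_k : (k.+1 < n.+1)%N by rewrite ltnS ltn_ord.
have := mroots_coeff (Tuple se) (Ordinal lt_k); rewrite /= -char_polyE_eigs => ->.
rewrite mulrA -exprMn mulrNN mulr1 expr1n mul1r; apply: meval_eq => i.
by rewrite (tnth_nth 0).
Qed.

(** [mweight] gives the variable of index [k] the weight [k.+1], which bounds the degree of
    [es k]. *)
Lemma size_mmap_weight (t : {mpoly C[n]}) : (size (mmap polyC es t) <= mweight t)%N.
Proof.
rewrite /mmap; apply: leq_trans (size_sum _ _ _) _; apply/bigmax_leqP_seq => m mt _.
apply: (@leq_trans (mnmwgt m).+1); last exact: mmeasure_mnm_lt.
rewrite mul_polyC; apply: leq_trans (size_scale_leq _ _) _.
rewrite /mmap1 /mnmwgt; elim/big_rec2: _ => [|i a p _ IH]; first by rewrite size_poly1.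
apply: leq_trans (size_polyMleq _ _) _.
have h1 : (size (es i ^+ m i)%R <= (m i * i.+1).+1)%N.
  apply: leq_trans (size_poly_exp_leq _ _) _; rewrite ltnS mulnC leq_mul2l.
  have := size_es i; case: (size (es i)) => [|k] /=; rewrite ?orbT //.
  by rewrite ltnS => ->; rewrite orbT.
have aux (u v x y : nat) : (u <= x.+1 -> v <= y.+1 -> (u + v).-1 <= (x + y).+1)%N by lia.
exact: aux h1 IH.
Qed.

(** Single eigenvalues of the pencil need not be polynomial in [y], but symmetric functions of them
    are: each coefficient of [formsP] is written in elementary symmetric polynomials, for which [es]
    is substituted. The weight bound of the fundamental theorem becomes the total degree bound. *)
Lemma exists_rpoly : exists P : {poly {poly C}},
  [/\ P \is monic, size P = (degc c).+1, wdeg (degc c) P &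
      forall y, ev y P = pc (A0 + y *: A1) c].
Proof.
pose t i := sval (sym_fundamental (formsP_sym i)).
pose P := \poly_(i < (degc c).+1) mmap polyC es (t i).
have tE i y : (mmap polyC es (t i)).[y] = (pc (A0 + y *: A1) c)`_i.
  rewrite /t; case: sym_fundamental => /= ti [tiE _].
  have -> : pc (A0 + y *: A1) c = pcl c (eig (A0 + y *: A1)) by [].
  rewrite -map_formsP coef_map -tiE /= comp_mpoly_meval mevalE /mmap horner_sum.
  apply: eq_bigr => m _; rewrite hornerM hornerC /mmap1 horner_prod; congr (_ * _).
  by apply: eq_bigr => i' _; rewrite horner_exp horner_es tnth_mktuple.
have lP : P`_(degc c) = 1.
  apply: polyP_horner => y; rewrite coef_poly ltnSn tE hornerC.
  have := monic_pcl c (eig (A0 + y *: A1)); rewrite monicE lead_coefE size_pcl.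
  by move/eqP.
have sP : size P = (degc c).+1.
  apply/eqP; rewrite eqn_leq size_poly /= ltnNge.
  by apply/negP => /leq_sizeP/(_ _ (leqnn _)) /eqP; rewrite lP oner_eq0.
exists P; split => //.
- by rewrite monicE lead_coefE sP lP.
- apply: wdegP => i; rewrite coef_poly; case: ifP => _; last by rewrite size_poly0.
  apply: leq_trans (size_mmap_weight _) _.
  rewrite /t; case: sym_fundamental => /= ti [_ w].
  exact: leq_trans w (msize_formsP i).
move=> y; apply/polyP => i; rewrite coef_ev coef_poly.
case: ltnP => h; first exact: tE.
by rewrite horner0 nth_default // size_pcl.
Qed.

End RPoly.

(** * Eigenvalues of Hermitian matrices *)

Section Adjoint.
Variable C : numClosedFieldType.

Lemma adjmxM (m n p : nat) (A : 'M[C]_(m, n)) (B : 'M[C]_(n, p)) :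
  adjmx (A *m B) = adjmx B *m adjmx A.
Proof. by rewrite /adjmx map_mxM trmx_mul. Qed.

Lemma adjmxK (m n : nat) (A : 'M[C]_(m, n)) : adjmx (adjmx A) = A.
Proof. by apply/matrixP => i j; rewrite !mxE conjCK. Qed.

Lemma adjmxE (m n : nat) (A : 'M[C]_(m, n)) : adjmx A = map_mx Num.conj A^T.
Proof. by apply/matrixP => i j; rewrite !mxE. Qed.

Lemma adjmxZ (m n : nat) (a : C) (A : 'M[C]_(m, n)) :
  adjmx (a *: A) = a^* *: adjmx A.
Proof. by apply/matrixP => i j; rewrite !mxE rmorphM. Qed.

Lemma adjmxD (m n : nat) (A B : 'M[C]_(m, n)) : adjmx (A + B) = adjmx A + adjmx B.
Proof. by apply/matrixP => i j; rewrite !mxE rmorphD. Qed.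

Lemma Hth_adj (n : nat) (u : C) (A : 'M[C]_n) : adjmx (Hth u A) = Hth u A.
Proof.
rewrite /Hth adjmxZ adjmxD !adjmxZ adjmxK conjCK addrC; congr (_ *: _).
by rewrite fmorphV rmorph_nat.
Qed.

Definition qf (n : nat) (M : 'M[C]_n) (x : 'cV[C]_n) : C :=
  (adjmx x *m M *m x) 0 0.

Lemma qf_adj (n : nat) (M : 'M[C]_n) (x : 'cV[C]_n) : qf (adjmx M) x = (qf M x)^*.
Proof.
have -> : (qf M x)^* = (adjmx (adjmx x *m M *m x)) 0 0 by rewrite [RHS]mxE [RHS]mxE.
by rewrite !adjmxM adjmxK mulmxA.
Qed.

Lemma qf_Hth (n : nat) (u : C) (A : 'M[C]_n) (x : 'cV[C]_n) :
  qf (Hth u A) x = 'Re (u * qf A x).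
Proof.
rewrite ReE rmorphM /= -qf_adj /qf /Hth -scalemxAr -scalemxAl mxE mulrC.
rewrite mulmxDr mulmxDl mxE -!scalemxAr -!scalemxAl.
by congr ((_ + _) / _); rewrite mxE.
Qed.

Lemma qf_norm (n : nat) (A : 'M[C]_n) (x : 'cV[C]_n) :
  `|qf A x| <= (\sum_i \sum_j `|A i j|) * qf 1%:M x.
Proof.
have nE : qf 1%:M x = \sum_i `|x i 0| ^+ 2.
  rewrite /qf mulmx1 mxE; apply: eq_bigr => i _; rewrite !mxE normCK mulrC //.
have le_n i : `|x i 0| ^+ 2 <= qf 1%:M x.
  by rewrite nE (bigD1 i) //= lerDl sumr_ge0 // => j _; rewrite exprn_ge0.
have le_nn i j : `|x i 0| * `|x j 0| <= qf 1%:M x.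
  have h : (`|x i 0| * `|x j 0|) *+ 2 <= (qf 1%:M x) *+ 2.
    apply: (@le_trans _ _ (`|x i 0| ^+ 2 + `|x j 0| ^+ 2)).
      rewrite -subr_ge0 addrAC -sqrrB real_exprn_even_ge0 //.
      by rewrite realB ?normr_real.
    by rewrite mulr2n lerD.
  by rewrite -(ler_pMn2r (n := 2)).
have -> : qf A x = \sum_i \sum_j (x i 0)^* * A i j * x j 0.
  rewrite /qf mxE exchange_big /=; apply: eq_bigr => j _.
  by rewrite mxE mulr_suml; apply: eq_bigr => i _; rewrite !mxE.
apply: le_trans (ler_norm_sum _ _ _) _; rewrite mulr_suml; apply: ler_sum => i _.
apply: le_trans (ler_norm_sum _ _ _) _; rewrite mulr_suml; apply: ler_sum => j _.
by rewrite !normrM norm_conjC mulrAC mulrC ler_wpM2l.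
Qed.

End Adjoint.

Section Spectral.
Variables (C : numClosedFieldType) (n : nat).
Implicit Types H : 'M[C]_n.

(** The spectral theorem lists the eigenvalues in some order, [heig] in sorted order; a permutation
    matching the two lists is applied to the eigenvector columns. *)
Lemma heig_spectral H : adjmx H = H ->
  exists X : 'M[C]_n, [/\ adjmx X *m X = 1%:M,
    H *m X = X *m diag_mx (\row_j heig H j) & forall j, heig H j \is Num.real].
Proof.
move=> Hadj.
have Hherm : H \is hermsymmx.
  by apply/is_hermitianmxP; rewrite expr0 scale1r -adjmxE Hadj.
have /orthomx_spectralP := hermitian_normalmx Hherm.
have /unitarymxP := spectral_unitarymx H.
have /mxOverP dreal := hermitian_spectral_diag_real Hherm.
have Pu := spectral_unit H.
rewrite invmx_unitary ?spectral_unitarymx // -!adjmxE.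
set P := spectralmx H in Pu *; set d := spectral_diag H in dreal * => PP HE.
have PP' : adjmx P *m P = 1%:M by apply: mulmx1C.
have cpH : char_poly H = \prod_(i < n) ('X - (d 0 i)%:P).
  rewrite (eq_bigr (fun i => 'X - (diag_mx d i i)%:P)); last first.
    by move=> i _; rewrite mxE eqxx mulr1n.
  rewrite -char_poly_trig ?diag_mx_is_trig //.
  apply: polyP_horner => t; rewrite !horner_char_poly.
  have -> : t%:M - H = adjmx P *m (t%:M - diag_mx d) *m P.
    by rewrite mulmxBr mulmxBl -HE scalar_mxC -mulmxA PP' mulmx1.
  by rewrite !det_mulmx mulrAC -det_mulmx PP' det1 mul1r.
have pe : perm_eq (sort (fun x y : C => 'Re y <= 'Re x) (eigs H)) [tuple d 0 i | i < n].
  rewrite perm_sort; apply: prod_XsubC_eq; rewrite -char_polyE_eigs cpH /=.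
  by rewrite big_map big_enum.
have [s sE] := tuple_permP pe.
have hE j : heig H j = d 0 (s j).
  by rewrite /heig sE -tnth_nth !tnth_mktuple.
exists (\matrix_(i, j) adjmx P i (s j)); split; last by move=> j; rewrite hE.
  apply/matrixP => i j; rewrite !mxE.
  have /matrixP/(_ (s i) (s j)) := PP; rewrite !mxE (inj_eq perm_inj) => <-.
  by apply: eq_bigr => k _; rewrite !mxE conjCK.
have HP : H *m adjmx P = adjmx P *m diag_mx d by rewrite {1}HE -[LHS]mulmxA PP mulmx1.
apply/matrixP => i j; rewrite mul_mx_diag !mxE hE.
have /matrixP/(_ i (s j)) := HP; rewrite mul_mx_diag !mxE => <-.
by apply: eq_bigr => k _; rewrite !mxE.
Qed.

Lemma heig_real H j : adjmx H = H -> heig H j \is Num.real.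
Proof. by move=> /heig_spectral[X []]. Qed.

Lemma heig_sorted H (i j : 'I_n) : adjmx H = H -> (i <= j)%N -> heig H j <= heig H i.
Proof.
move=> Hadj ij; have Re_h k : heig H k = 'Re (heig H k).
  by rewrite (Creal_ReP _ _) // heig_real.
rewrite Re_h [X in _ <= X]Re_h.
have := @sorted_leq_nth C (fun x y : C => 'Re y <= 'Re x).
apply=> //.
- by move=> y x z xy yz; exact: le_trans yz xy.
- by apply: sort_sorted => x y; rewrite real_leVge ?Creal_Re.
- by rewrite inE size_sort size_eigs.
- by rewrite inE size_sort size_eigs.
Qed.

Lemma qf_diag H X (a : 'cV[C]_n) : adjmx X *m X = 1%:M ->
    H *m X = X *m diag_mx (\row_j heig H j) ->
  qf H (X *m a) = \sum_j heig H j * `|a j 0| ^+ 2.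
Proof.
move=> XX HX; rewrite /qf adjmxM -!mulmxA [H *m _]mulmxA HX -mulmxA.
rewrite [adjmx X *m _]mulmxA XX mul1mx mulmxA mul_mx_diag mxE.
by apply: eq_bigr => j _; rewrite !mxE normCK; ring.
Qed.

Lemma qf1_unitary (X : 'M[C]_n) (a : 'cV[C]_n) : adjmx X *m X = 1%:M ->
  qf 1%:M (X *m a) = \sum_j `|a j 0| ^+ 2.
Proof.
move=> XX; rewrite /qf adjmxM mulmx1 -!mulmxA [adjmx X *m _]mulmxA XX mul1mx mxE.
by apply: eq_bigr => j _; rewrite !mxE normCK mulrC.
Qed.

(** Dimension count: [j.+1] free coordinates against [j] linear equations. *)
Lemma ker_corner (Y : 'M[C]_n) (j : 'I_n) : exists a : 'cV[C]_n,
  [/\ a != 0, forall k : 'I_n, (j < k)%N -> a k 0 = 0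
    & forall i : 'I_n, (i < j)%N -> (Y *m a) i 0 = 0].
Proof.
have jn : (j.+1 <= n)%N by exact: ltn_ord.
(* The corner of [Y] is transposed because [kermx] is a left kernel. *)
pose N : 'M[C]_(j.+1, j) :=
  \matrix_(k, i) Y (widen_ord (ltnW jn) i) (widen_ord jn k).
have : kermx N != 0.
  by rewrite -mxrank_eq0 mxrank_ker -lt0n subn_gt0 ltnS rank_leq_col.
case/rowV0Pn => b /sub_kermxP bN nz_b.
exists (\col_k if insub (nat_of_ord k) is Some k' then b 0 k' else 0); split.
- apply: contraNneq nz_b => /colP b0; apply/eqP/rowP => k.
  by have := b0 (widen_ord jn k); rewrite !mxE /= valK.
- by move=> k jk; rewrite mxE insubF // ltnS leqNgt jk.
move=> i ij; have /rowP/(_ (Ordinal ij)) := bN; rewrite !mxE => e; rewrite -[RHS]e.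
rewrite (eq_bigr (fun k : 'I_n => if (k < j.+1)%N then
   b 0 (inord k) * Y i k else 0)); last first.
  move=> k _; rewrite mxE; case: ifP => kj; last by rewrite insubF // mulr0.
  rewrite insubT mulrC; congr (_ * _); congr (b _ _).
  by apply: val_inj; rewrite /= inordK.
rewrite -big_mkcond (big_ord_narrow jn) /=; apply: eq_bigr => k _.
rewrite !mxE; congr (_ * _); last by congr (Y _ _); apply: val_inj.
by congr (b _ _); apply: val_inj; rewrite /= inordK.
Qed.

(* Weyl's inequality: the span of the top j+1 eigenvectors of one matrix meets
   the span of the bottom n-j eigenvectors of the other one. *)
Lemma heig_Hth_le (A : 'M[C]_n) (u u' : C) (j : 'I_n) :
  heig (Hth u A) j <= heig (Hth u' A) j + (\sum_i \sum_k `|A i k|) * `|u - u'|.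
Proof.
have [X [XX HX _]] := heig_spectral (Hth_adj u A).
have [X' [XX' HX' _]] := heig_spectral (Hth_adj u' A).
have [a [nz_a a0 b0]] := ker_corner (adjmx X' *m X) j.
(* [a] and [b] are the coordinates of one vector in the two eigenbases: [a] is supported on the
   first [j.+1] indices, [b] vanishes on the first [j]. *)
set b := adjmx X' *m X *m a in b0.
have xE : X *m a = X' *m b by rewrite /b !mulmxA (mulmx1C XX') mul1mx.
set s := \sum_k `|a k 0| ^+ 2.
have sb : s = \sum_k `|b k 0| ^+ 2.
  by rewrite -(qf1_unitary _ XX') -xE (qf1_unitary _ XX).
have s_gt0 : 0 < s.
  have [k ak] : exists k, a k 0 != 0 by apply/cV0Pn.
  rewrite /s (bigD1 k) //= ltr_wpDr ?sumr_ge0 // => [i _|]; first by rewrite exprn_ge0.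
  by rewrite exprn_gt0 ?normr_gt0.
rewrite -(ler_pM2r s_gt0).
have h1 : heig (Hth u A) j * s <= qf (Hth u A) (X *m a).
  rewrite (qf_diag _ XX HX) mulr_sumr; apply: ler_sum => k _.
  have [kj|/a0 ->] := leqP k j; last by rewrite normr0 expr0n !mulr0.
  by rewrite ler_wpM2r ?exprn_ge0 // heig_sorted ?Hth_adj.
have h2 : qf (Hth u' A) (X *m a) <= heig (Hth u' A) j * s.
  rewrite xE (qf_diag _ XX' HX') sb mulr_sumr; apply: ler_sum => k _.
  have [jk|/b0 ->] := leqP j k; last by rewrite normr0 expr0n !mulr0.
  by rewrite ler_wpM2r ?exprn_ge0 // heig_sorted ?Hth_adj.
apply: le_trans h1 _; rewrite mulrDl.
have -> : qf (Hth u A) (X *m a) =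
    qf (Hth u' A) (X *m a) + 'Re ((u - u') * qf A (X *m a)).
  by rewrite !qf_Hth -raddfD /= -mulrDl addrC subrK.
apply: lerD h2 _; apply: le_trans (leif_Re_Creal _) _.
rewrite normrM mulrAC mulrC ler_wpM2r //.
by rewrite /s -(qf1_unitary _ XX) qf_norm.
Qed.

End Spectral.

Section Support.
Variables (C : numClosedFieldType) (n : nat) (A : 'M[C]_n) (c : 'I_n -> C).
Hypothesis hc : forall i, c i \is Num.real.

Definition sup (u : C) : C := \sum_(j < n) c j * heig (Hth u A) j.

Lemma sup_real u : sup u \is Num.real.
Proof. by apply: sum_real => j _; rewrite realM // heig_real // Hth_adj. Qed.

Lemma sup_lipschitz : exists2 K : C, 0 <= K &
  forall u u', sup u <= sup u' + K * `|u - u'|.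
Proof.
set K0 := \sum_i \sum_k `|A i k|.
have K0_ge0 : 0 <= K0 by apply: sumr_ge0 => i _; apply: sumr_ge0.
exists ((\sum_j `|c j|) * K0); first by rewrite mulr_ge0 // sumr_ge0.
move=> u u'; rewrite -lerBlDl /sup -sumrB -mulrA mulr_suml; apply: ler_sum => j _.
rewrite -mulrBr.
apply: le_trans (real_ler_norm _) _.
  by rewrite realM // realB // heig_real // Hth_adj.
rewrite normrM ler_wpM2l //.
have lr v : heig (Hth v A) j \is Num.real by rewrite heig_real // Hth_adj.
rewrite real_ler_norml ?realB // lerNl opprB lerBlDl [X in _ && X]lerBlDl.
by rewrite heig_Hth_le andbT distrC heig_Hth_le.
Qed.

(** The orthonormal system is an eigenbasis of [Hth u A] ordered as in [heig], so each quadratic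
    form value is the matching eigenvalue. *)
Lemma Wc_sup u : exists2 v, Wc A c v & 'Re (u * v) = sup u.
Proof.
have [X [XX HX _]] := heig_spectral (Hth_adj u A).
exists (\sum_(j < n) (c j * (adjmx (col j X) *m A *m col j X) 0 0)); first by exists X.
rewrite mulr_sumr raddf_sum /=; apply: eq_bigr => j _.
rewrite mulrCA ReMl //; congr (_ * _).
rewrite -/(qf A (col j X)) -qf_Hth colE (qf_diag _ XX HX) (bigD1 j) //= big1 ?addr0.
  by rewrite mxE !eqxx normr1 expr1n mulr1.
by move=> k kj; rewrite mxE (negbTE kj) normr0 expr0n mulr0.
Qed.

End Support.

(** * Supporting lines *)

Section Bounds.
Variable C : numClosedFieldType.

Lemma pos_common_lb (a b : C) : 0 < a -> 0 < b ->
  exists d : C, [/\ 0 < d, d <= a & d <= b].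
Proof.
move=> a0 b0; have /orP[ab|ba] := real_leVge (gtr0_real a0) (gtr0_real b0).
  by exists a.
by exists b.
Qed.

Lemma norm_Re_le (z : C) : `|'Re z| <= `|z|.
Proof.
rewrite real_ler_norml ?Creal_Re // lerNl -raddfN /=; apply/andP; split.
  by rewrite -[leRHS]normrN; exact: leif_Re_Creal.
exact: leif_Re_Creal.
Qed.

Lemma horner_norm_le (p : {poly C}) (y : C) : `|y| <= 1 ->
  `|p.[y]| <= \sum_(i < size p) `|p`_i|.
Proof.
move=> y1; rewrite horner_coef; apply: le_trans (ler_norm_sum _ _ _) _.
apply: ler_sum => i _; rewrite normrM normrX -[leRHS]mulr1.
by rewrite ler_wpM2l // exprn_ile1.
Qed.

Lemma ev_lipschitz (q : {poly {poly C}}) (M : C) : 0 <= M ->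
  exists2 K : C, 0 <= K & forall y a b, `|y| <= 1 -> `|a| <= M -> `|b| <= M ->
    `|(ev y q).[a] - (ev y q).[b]| <= K * `|a - b|.
Proof.
move=> M0.
(* Induction along Horner's scheme: the product rule for the Lipschitz constant [K] calls for a
   uniform bound [K'] as well. *)
suff [K [K' [K0 K'0 hK hK']]] : exists K K' : C, [/\ 0 <= K, 0 <= K',
    (forall y a b, `|y| <= 1 -> `|a| <= M -> `|b| <= M ->
      `|(ev y q).[a] - (ev y q).[b]| <= K * `|a - b|) &
    (forall y a, `|y| <= 1 -> `|a| <= M -> `|(ev y q).[a]| <= K')] by exists K.
elim/poly_ind: q => [|q p [K [K' [K0 K'0 hK hK']]]].
  exists 0, 0; split => // [y a b _ _ _|y a _ _].
    by rewrite rmorph0 !horner0 subrr normr0 mul0r.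
  by rewrite rmorph0 horner0 normr0.
have evE y a : (ev y (q * 'X + p%:P)).[a] = (ev y q).[a] * a + p.[y].
  by rewrite rmorphD rmorphM /= evC [ev y 'X]map_polyX !hornerE.
pose B := \sum_(i < size p) `|p`_i|.
have B0 : 0 <= B by apply: sumr_ge0.
exists (K * M + K'), (K' * M + B); split; rewrite ?addr_ge0 ?mulr_ge0 //.
  move=> y a b y1 aM bM; rewrite !evE.
  have -> : (ev y q).[a] * a + p.[y] - ((ev y q).[b] * b + p.[y]) =
     ((ev y q).[a] - (ev y q).[b]) * a + (ev y q).[b] * (a - b) by ring.
  apply: le_trans (ler_normD _ _) _; rewrite [leRHS]mulrDl !normrM; apply: lerD.
    by rewrite mulrAC ler_pM // hK.
  by rewrite ler_wpM2r // hK'.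
move=> y a y1 aM; rewrite evE; apply: le_trans (ler_normD _ _) _.
by rewrite normrM lerD ?ler_pM ?hK' // horner_norm_le.
Qed.

Lemma prod_XsubC_norm_ge (rs : seq C) (x d : C) : 0 <= d ->
  (forall b, b \in rs -> d <= `|x - b|) ->
  d ^+ size rs <= `|(\prod_(b <- rs) ('X - b%:P)).[x]|.
Proof.
move=> d0; elim: rs => [|b rs IH] hrs; first by rewrite big_nil hornerC normr1 expr0.
rewrite big_cons hornerM hornerXsubC normrM exprS.
apply: ler_pM; rewrite ?exprn_ge0 // ?hrs ?mem_head //.
by apply: IH => b' b'rs; rewrite hrs // in_cons b'rs orbT.
Qed.

End Bounds.

(** * Attained minima on the unit circle *)

Section CircleGap.
Variables (C : numClosedFieldType) (n : nat) (A : 'M[C]_n) (c : 'I_n -> C).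
Hypothesis hc : forall i, c i \is Num.real.

Lemma unit_mulJ (u : C) : `|u| = 1 -> u * u^* = 1.
Proof. by move=> u1; rewrite -normCK u1 expr1n. Qed.

Lemma pencil_Hth (u : C) : `|u| = 1 ->
  A + (u^* ^+ 2) *: adjmx A = (2%:R * u^*) *: Hth u A.
Proof.
move=> /unit_mulJ uu; rewrite /Hth scalerA scalerDr !scalerA.
have -> : 2%:R * u^* / 2%:R * u = 1 :> C.
  by transitivity (u * u^*) => //; field.
by rewrite scale1r; congr (_ + _ *: _); field.
Qed.

Lemma root_pencil (u t : C) : `|u| = 1 -> root (pc (Hth u A) c) t ->
  root (pc (A + (u^* ^+ 2) *: adjmx A) c) (2%:R * u^* * t).
Proof.
move=> u1 /rootP rt; apply/rootP; rewrite pencil_Hth // pc_scale ?rt ?mulr0 //.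
by rewrite mulf_neq0 ?pnatr_eq0 // conjC_eq0 -normr_eq0 u1 oner_eq0.
Qed.

(* The minimum over the unit circle of the continuous semialgebraic function
   [sup u - Re (u p)] is attained.  The factor [w - (p + y p^* )] is first divided
   out of the polynomial of [sup]; what remains vanishes on the line
   [w = p + y p^*] at finitely many [y] only, and small values of the function
   force [y = u^* ^+ 2] close to one of these. *)
Lemma circle_gap (p : C) :
  (forall u, `|u| = 1 -> 'Re (u * p) < sup A c u) ->
  exists2 e : C, 0 < e & forall u, `|u| = 1 -> 'Re (u * p) + e <= sup A c u.
Proof.
move=> gpos.
pose g u := sup A c u - 'Re (u * p).
have g_gt0 u : `|u| = 1 -> 0 < g u by move=> u1; rewrite subr_gt0 gpos.
have g_real u : g u \is Num.real by rewrite realB ?sup_real ?Creal_Re.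
suff [e e0 he] : exists2 e : C, 0 < e & forall u, `|u| = 1 -> e <= g u.
  by exists e => // u u1; rewrite addrC -lerBrDr he.
have [P [mP _ _ evP]] := exists_rpoly c A (adjmx A).
(* At [y = u^* ^+ 2] the value of [x0] is [2%:R * u^* * 'Re (u * p)], which differs from the root
   given by [sup] by [2%:R * u^* * g u]. *)
pose x0 : {poly C} := p%:P + p^* *: 'X.
have [m [q nrq PE]] := multiplicity_XsubC P x0.
rewrite monic_neq0 //= in nrq.
(* Composing with the square makes [S] a polynomial in the conjugate of [u]; it is nonzero because
   [x0] is not a root of [q]. *)
pose S : {poly C} := q.[x0] \Po 'X^2.
have nzS : S != 0.
  by rewrite /S comp_poly_eq0 ?size_polyXn.
have [rs SE] := closed_field_poly_normal S.
have nz_lc : lead_coef S != 0 by rewrite lead_coef_eq0.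
(* This radius bounds both [x0.[y]] and the root given by [sup] as soon as [g u <= 1]. *)
have [|K K0 hK] := @ev_lipschitz _ q (2%:R * (`|p| + 1)).
  by rewrite mulr_ge0 ?addr_ge0.
have [Kg Kg0 hKg] := sup_lipschitz A hc.
have gS u : `|u| = 1 -> g u <= 1 -> `|S.[u^*]| <= K * 2%:R * g u.
  move=> u1 g1; pose y := u^* ^+ 2.
  have y1 : `|y| <= 1 by rewrite normrX norm_conjC u1 expr1n.
  have n2u : `|2%:R * u^*| = 2%:R by rewrite normrM norm_conjC u1 mulr1 normr_nat.
  have x0E : x0.[y] = 2%:R * u^* * 'Re (u * p).
    have uu := unit_mulJ u1.
    transitivity (u * u^* * p + u^* ^+ 2 * p^*).
      by rewrite uu mul1r /x0 hornerD hornerC hornerZ hornerX [p^* * _]mulrC.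
    by rewrite ReE rmorphM; field.
  have dE : 2%:R * u^* * sup A c u - x0.[y] = 2%:R * u^* * g u by rewrite x0E -mulrBr.
  (* Since [g u] is nonzero, the removed power does not vanish at this root of [P], so [q] does.
     Hence [S] at the conjugate of [u] is a difference of two values of [q] at distance
     [2%:R * g u]. *)
  have r_sup : root (ev y q) (2%:R * u^* * sup A c u).
    have : root (ev y P) (2%:R * u^* * sup A c u).
      by rewrite evP; apply: root_pencil => //; exact: heig_sum_root.
    rewrite PE rmorphM rmorphXn rmorphB /= evC [ev y 'X]map_polyX rootM => /orP[] //.
    rewrite rootE horner_exp hornerXsubC dE expf_eq0 mulf_eq0 -[_ * _ == 0]normr_eq0 n2u.
    by rewrite pnatr_eq0 /= (gt_eqF (g_gt0 _ u1)) andbF.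
  have SyE : S.[u^*] = (ev y q).[x0.[y]] - (ev y q).[2%:R * u^* * sup A c u].
    rewrite (rootP r_sup) subr0 /S horner_comp hornerXn -/y.
    exact: esym (horner_map (horner_eval y) q x0).
  have ReL : `|'Re (u * p)| <= `|p|.
    rewrite (le_trans (norm_Re_le _)) // normrM u1 mul1r //.
  rewrite SyE; apply: le_trans (hK _ _ _ y1 _ _) _.
  - by rewrite x0E normrM n2u ler_wpM2l // (le_trans ReL) // lerDl.
  - rewrite normrM n2u ler_wpM2l //.
    have -> : sup A c u = 'Re (u * p) + g u by rewrite /g addrC subrK.
    apply: le_trans (ler_normD _ _) _; apply: lerD => //.
    by rewrite gtr0_norm ?g_gt0.
  by rewrite distrC dE normrM n2u mulrA gtr0_norm ?g_gt0.
have [d d0 hd] : exists2 d : C, 0 < d & forall b, b \in rs ->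
    forall u, `|u| = 1 -> `|u^* - b| < d -> d <= g u.
  (* A root off the circle keeps a positive distance from it; at a root on the circle [g] is
     positive, and the Lipschitz bound keeps it so nearby. *)
  have step b : exists2 d : C, 0 < d & forall u, `|u| = 1 -> `|u^* - b| < d -> d <= g u.
    have [b1|b1] := eqVneq `|b| 1; last first.
      exists `| `|b| - 1|; first by rewrite normr_gt0 subr_eq0.
      move=> u u1 /lt_geF; rewrite distrC.
      by have := ler_dist_dist u^* b; rewrite norm_conjC u1 => ->.
    have g0 : 0 < g b^* by rewrite g_gt0 ?norm_conjC.
    pose Kp := Kg + `|p|.
    have Kp_ge0 : 0 <= Kp by rewrite addr_ge0.
    have Kp0 : 0 < Kp + 1 by rewrite ltr_wpDl.
    (* This [d] solves [g b^* - Kp * d = d], so the Lipschitz lower bound for [g u] is again [d]. *)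
    exists (g b^* / (Kp + 1)); first by rewrite divr_gt0.
    move=> u u1 hu.
    have hd1 : `|u - b^*| < g b^* / (Kp + 1) by rewrite -norm_conjC rmorphB /= conjCK.
    have h1 : g b^* <= g u + Kp * `|u - b^*|.
      have -> : g u + Kp * `|u - b^*| = (sup A c u + Kg * `|b^* - u|) +
          (`|u - b^*| * `|p| - 'Re (u * p)) by rewrite distrC /g /Kp; ring.
      rewrite lerD ?hKg // lerBrDr addrC -raddfB /= -mulrBl -normrM.
      exact: leif_Re_Creal.
    rewrite -(lerD2r (Kp * (g b^* / (Kp + 1)))).
    have -> : g b^* / (Kp + 1) + Kp * (g b^* / (Kp + 1)) = g b^*.
      by field; rewrite gt_eqF.
    by rewrite (le_trans h1) // lerD2l ler_wpM2l ?(ltW hd1).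
  elim: rs {SE} => [|b rs [d d0 hd]]; first by exists 1.
  have [d' d'0 hd'] := step b; have [d'' [d''0 h1 h2]] := pos_common_lb d0 d'0.
  exists d'' => // x; rewrite in_cons => /predU1P[->|xrs] u u1 hu.
    by rewrite (le_trans h2) // hd' // (lt_le_trans hu).
  by rewrite (le_trans h1) // (hd x) // (lt_le_trans hu).
have [e1 [e1_gt0 e1d e11]] := pos_common_lb d0 (@ltr01 C).
(* Away from the roots [S] has norm at least [B], while [gS] would make it smaller than [B] if
   [g u < e]. *)
pose B := `|lead_coef S| * d ^+ size rs.
have B0 : 0 < B by rewrite mulr_gt0 ?normr_gt0 // exprn_gt0.
have B'0 : 0 < B / (K * 2%:R + 1) by rewrite divr_gt0 // ltr_wpDl // mulr_ge0 // ler0n.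
have [e [e_gt0 ee1 eB]] := pos_common_lb e1_gt0 B'0.
exists e => // u u1; rewrite real_leNgt ?(gtr0_real e_gt0) //; apply/negP => ge.
have g1 : g u <= 1 by rewrite (le_trans (ltW ge)) // (le_trans ee1).
have [/hasP[b brs hb]|/hasPn far] := boolP (has (fun b => `|u^* - b| < d) rs).
  have := lt_le_trans ge (le_trans (le_trans ee1 e1d) (hd b brs u u1 hb)).
  by rewrite ltxx.
have : B <= `|S.[u^*]|.
  rewrite SE hornerZ normrM /B; apply: ler_wpM2l => //.
  apply: prod_XsubC_norm_ge => [|b /far]; first exact: ltW.
  by rewrite -real_leNgt ?normr_real ?gtr0_real.
move/le_trans/(_ (gS u u1 g1)); apply/negP; set K2 := K * 2%:R.
have K20 : 0 <= K2 by rewrite mulr_ge0.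
have K21 : K2 + 1 != 0 by rewrite gt_eqF // ltr_wpDl.
have hlt : K2 * g u < B.
  apply: (@le_lt_trans _ _ (K2 * (B / (K2 + 1)))).
    by rewrite ler_wpM2l // (le_trans (ltW ge)).
  have -> : K2 * (B / (K2 + 1)) = B - B / (K2 + 1) by field.
  by rewrite ltrBlDr ltrDl.
by rewrite lt_geF.
Qed.

End CircleGap.

Section SupportValue.
Variables (C : numClosedFieldType) (n : nat) (A : 'M[C]_n) (c : 'I_n -> C).
Hypothesis hc : forall i, c i \is Num.real.

Lemma Wrange_closed (p : C) : closure_point (Wrange A c) p -> Wrange A c p.
Proof.
move=> clo u u1; rewrite -/(sup A c u) real_leNgt ?Creal_Re ?sup_real //.
apply/negP => lt_sup.
have e_gt0 : 0 < 'Re (u * p) - sup A c u by rewrite subr_gt0.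
have [z [Wz zp]] := clo _ e_gt0.
have := Wz u u1; rewrite -/(sup A c u) => hz.
have hpz : 'Re (u * p) - 'Re (u * z) <= `|z - p|.
  rewrite -raddfB /= -mulrBr; apply: le_trans (leif_Re_Creal _) _.
  by rewrite normrM u1 mul1r distrC.
have := le_lt_trans hpz zp; rewrite ltrD2l ltrN2 => /(le_lt_trans hz).
by rewrite ltxx.
Qed.

Lemma gap_interior (p e : C) : 0 < e ->
    (forall u, `|u| = 1 -> 'Re (u * p) + e <= sup A c u) ->
  interior_point (Wrange A c) p.
Proof.
move=> e0 gap; exists e; split => // z zp u u1; apply: le_trans (gap u u1).
have -> : u * z = u * p + u * (z - p) by ring.
rewrite raddfD /= lerD2l; apply: le_trans (leif_Re_Creal _) _.
by rewrite normrM u1 mul1r ltW.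
Qed.

(** Moving from [p] along the line by ['i * u^*] must stay on the other line; this makes the
    unimodular number [u0 * u^*] real, hence 1 or -1. *)
Lemma line_of_direction (u t u0 t0 p : C) : `|u| = 1 -> `|u0| = 1 ->
    line_of u t p -> (forall z, line_of u t z <-> line_of u0 t0 z) ->
  u0 = u \/ u0 = - u.
Proof.
move=> u1 u01 Lp LL.
have uu := unit_mulJ u1; have uu0 := unit_mulJ u01.
have Lz : line_of u t (p + 'i * u^*).
  rewrite /line_of mulrDr mulrCA uu mulr1 raddfD /= Re_i addr0.
  exact: Lp.
have := (LL _).1 Lz; rewrite /line_of mulrDr raddfD /=.
have -> : 'Re (u0 * p) = t0 by exact: (LL p).1 Lp.
move/eqP; rewrite -subr_eq0 addrAC subrr add0r mulrCA ReMil oppr_eq0 => /eqP/Creal_ImP.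
set s := u0 * u^* => sR.
have u0E : u0 = s * u by rewrite /s mulrAC -mulrA uu mulr1.
have : s ^+ 2 == 1.
  have /CrealP s_conj := sR.
  rewrite expr2 -{2}s_conj /s rmorphM /= conjCK.
  have -> : u0 * u^* * (u0^* * u) = (u0 * u0^*) * (u * u^*) by ring.
  by rewrite uu uu0 mulr1.
rewrite sqrf_eq1 => /orP[] /eqP s1; rewrite u0E s1 ?mulN1r ?mul1r; by [left | right].
Qed.

Lemma support_value (u t : C) (L : C -> Prop) :
    `|u| = 1 -> t \is Num.real -> (forall z, L z <-> line_of u t z) ->
    (forall z, Wrange A c z -> 'Re (u * z) <= t) ->
    (exists z, Wrange A c z /\ L z) ->
    (forall z, Wrange A c z <-> Wc A c z) \/
      ((exists p, interior_point (Wrange A c) p) /\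
       exists p, L p /\ smooth_boundary_at (Wrange A c) p) ->
  sup A c u = t.
Proof.
move=> u1 tR LE Wt [z [Wz /LE Lz]] [WWc|[[q [e [e0 qint]]] [p [/LE Lp smooth]]]].
  apply: le_anti; apply/andP; split.
    by have [v Wv <-] := Wc_sup A hc u; apply/Wt/WWc.
  by have := Wz u u1; rewrite Lz.
have [[clo nint] [_ uniqL]] := smooth.
apply/eqP; apply: contraT => /eqP ne; case: nint.
(* Strict inequality in all directions would make [p] interior; an equality at [u0] gives a second
   supporting line at [p], which must be [L]. *)
suff gpos u0 : `|u0| = 1 -> 'Re (u0 * p) < sup A c u0.
  by have [d d0 gap] := circle_gap hc gpos; exact: gap_interior d0 gap.
move=> u01; rewrite lt_neqAle (Wrange_closed clo u01) andbT; apply/negP => /eqP Ep.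
have sL : supporting_line_at (Wrange A c) L p.
  split; first exact/LE.
  by exists u, t; split => //; rewrite -normr_gt0 u1.
have sL0 : supporting_line_at (Wrange A c) (line_of u0 (sup A c u0)) p.
  split; first exact: Ep.
  exists u0, (sup A c u0); split => //; rewrite ?sup_real // -?normr_gt0 ?u01 //.
  by move=> w /(_ u0 u01).
have LL w : line_of u t w <-> line_of u0 (sup A c u0) w.
  by rewrite -LE; exact: uniqL sL sL0 w.
have [u0E|u0E] := line_of_direction u1 u01 Lp LL.
  by apply: ne; rewrite -Lp -u0E Ep.
(* Case [u0 = - u]: the whole range would lie on the line [L], but the interior point [q] can be
   moved off it by [e / 2]. *)
have e2 : 0 < e / 2%:R by rewrite divr_gt0.
pose q' := q - (e / 2%:R) * u^*.
have Wq' : Wrange A c q'.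
  apply: qint; rewrite /q' addrAC subrr add0r normrN normrM norm_conjC u1 mulr1.
  by rewrite gtr0_norm // gtr_pMr // invf_lt1 // ltr1n.
have Wq : Wrange A c q by apply: qint; rewrite subrr normr0.
have := Wq' u0 u01; rewrite -/(sup A c u0) -Ep u0E !mulNr !raddfN lerN2 /= Lp.
rewrite /q' mulrBr mulrCA unit_mulJ // mulr1 raddfB /=.
rewrite (Creal_ReP _ (gtr0_real e2)) => h.
have := le_trans h (lerB (Wt q Wq) (lexx (e / 2%:R))).
by rewrite lerBrDl gerDr => /(lt_le_trans e2); rewrite ltxx.
Qed.

End SupportValue.

Lemma common_supporting_line_normalize (C : numClosedFieldType) (K1 K2 L : C -> Prop) :
    common_supporting_line K1 K2 L ->
  exists u t : C, [/\ `|u| = 1, t \is Num.real, forall z, L z <-> line_of u t z &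
    forall z, K1 z \/ K2 z -> 'Re (u * z) <= t].
Proof.
move=> [_ [_ [u [t [nz_u tR LE Kt]]]]].
have u0 : 0 < `|u| by rewrite normr_gt0.
have iR : `|u|^-1 \is Num.real by rewrite realV normr_real.
have ReE z : 'Re (u / `|u| * z) = 'Re (u * z) / `|u| by rewrite mulrAC (ReMr iR).
exists (u / `|u|), (t / `|u|); split.
- by rewrite normrM normfV normr_id divff // gt_eqF.
- by rewrite realM.
- move=> z; rewrite LE /line_of ReE; split => [->//|].
  by apply: mulIf; rewrite invr_eq0 gt_eqF.
by move=> z /Kt; rewrite ReE ler_pM2r ?invr_gt0.
Qed.

(** The square determines [u] up to sign, the second coordinate then fixes the sign of [t], and
    [(u, t)] and [(- u, - t)] give the same line. *)
Lemma same_pencil_point (C : numClosedFieldType) (u t u' t' : C) :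
    `|u| = 1 -> u^* ^+ 2 = u'^* ^+ 2 -> 2%:R * u^* * t = 2%:R * u'^* * t' ->
  forall z, line_of u t z <-> line_of u' t' z.
Proof.
move=> u1 /eqP; have nz : 2%:R * u^* != 0.
  by rewrite mulf_neq0 ?pnatr_eq0 // conjC_eq0 -normr_gt0 u1.
rewrite eqf_sqr => /orP[] /eqP uu.
  rewrite -uu => /(mulfI nz) -> z.
  by have -> : u = u' by apply: (can_inj conjCK).
have u'E : u' = - u by apply: (can_inj conjCK); rewrite rmorphN /= uu opprK.
have -> : u'^* = - u^* by rewrite uu opprK.
rewrite mulrN mulNr -mulrN => /(mulfI nz) -> z.
rewrite /line_of u'E mulNr raddfN /=.
by split => [->|/eqP]; rewrite ?opprK // eqr_oppLR => /eqP.
Qed.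

(** * Homogenization *)

HB.instance Definition _ (C : numClosedFieldType) (x y : C) :=
  GRing.RMorphism.copy (@eval_xy C x y) (horner_eval y \o map_poly (horner_eval x)).

Section Homogenize.
Variable C : numClosedFieldType.
Implicit Types (x y t : C).

Definition eval3 x y t (Q : {poly {poly {poly C}}}) : C :=
  (map_poly (eval_xy x y) Q).[t].

HB.instance Definition _ x y t :=
  GRing.RMorphism.copy (eval3 x y t) (horner_eval t \o map_poly (eval_xy x y)).

Lemma eval3X x y t : eval3 x y t 'X = t.
Proof. by rewrite /eval3 map_polyX hornerX. Qed.

Lemma eval3C x y t (q : {poly {poly C}}) : eval3 x y t q%:P = (ev x q).[y].
Proof. by rewrite /eval3 map_polyC hornerC. Qed.

Definition xvar : {poly {poly {poly C}}} := 'X%:P%:P.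

Lemma eval3_xvar x y t : eval3 x y t xvar = x.
Proof. by rewrite eval3C evC !hornerE. Qed.

Lemma eval3_inj (Q1 Q2 : {poly {poly {poly C}}}) :
  (forall x y t, x != 0 -> eval3 x y t Q1 = eval3 x y t Q2) -> Q1 = Q2.
Proof.
move=> E12; apply/polyP => k; apply/polyP => j.
have nzX : 'X != 0 :> {poly C} by rewrite polyX_eq0.
(* Nothing is assumed at [x = 0]; the extra factor ['X] forces agreement there. *)
apply: (mulIf nzX).
apply: polyP_horner => x; rewrite !hornerMX.
have [->|nz_x] := eqVneq x 0; first by rewrite !mulr0.
rewrite -!coef_ev; suff -> : ev x Q1`_k = ev x Q2`_k by [].
apply: polyP_horner => y.
have E (Q : {poly {poly {poly C}}}) : (ev x Q`_k).[y] = (map_poly (eval_xy x y) Q)`_k.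
  by rewrite coef_map.
rewrite !E; suff -> : map_poly (eval_xy x y) Q1 = map_poly (eval_xy x y) Q2 by [].
by apply: polyP_horner => t; exact: E12.
Qed.

(* In the next two lemmas [M] and [N] may exceed the degree: the spurious powers of
   [x] are stripped in [irreducible_cofactor]. *)
Lemma homogenize1 (g : {poly C}) : exists M (g' : {poly {poly C}}),
  (forall x y, x != 0 -> (ev x g').[y] = x ^+ M * g.[y / x]) /\ ev 1 g' = g.
Proof.
elim/poly_ind: g => [|g a [M [g' [Eg' g'1]]]].
  exists 0%N, 0; split => [x y _|]; last by rewrite rmorph0.
  by rewrite rmorph0 !horner0 mulr0.
have evE x : ev x (g' * 'X + (a *: 'X^(M.+1))%:P) = ev x g' * 'X + (a * x ^+ M.+1)%:P.
  by rewrite rmorphD rmorphM /= evC [ev x 'X]map_polyX hornerZ hornerXn.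
exists M.+1, (g' * 'X + (a *: 'X^(M.+1))%:P); split => [x y nz_x|]; rewrite evE.
  rewrite hornerD hornerC hornerMX Eg' // hornerD hornerMX hornerC.
  by rewrite exprS; field.
by rewrite g'1 expr1n mulr1.
Qed.

Lemma homogenize2 (G : {poly {poly C}}) : exists N (G' : {poly {poly {poly C}}}),
  (forall x y t, x != 0 -> eval3 x y t G' = x ^+ N * (ev (y / x) G).[t / x]) /\
  map_poly (ev 1) G' = G.
Proof.
elim/poly_ind: G => [|G g [N [G' [EG' G'1]]]].
  exists 0%N, 0; split => [x y t _|]; last by rewrite rmorph0.
  by rewrite !rmorph0 horner0 mulr0.
have [M [g' [Eg' g'1]]] := homogenize1 g.
have evE z : ev z (G * 'X + g%:P) = ev z G * 'X + g.[z]%:P.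
  by rewrite rmorphD rmorphM /= evC [ev z 'X]map_polyX.
exists (N.+1 + M)%N, (xvar ^+ M * G' * 'X + xvar ^+ N.+1 * g'%:P); split.
  move=> x y t nz_x; rewrite rmorphD !rmorphM !rmorphXn /= eval3X eval3C eval3_xvar.
  rewrite EG' // Eg' // evE hornerD hornerMX hornerC.
  by rewrite exprD exprS; field.
have ev1x : map_poly (ev 1) xvar = 1 :> {poly {poly C}}.
  by rewrite /xvar map_polyC /= evC hornerX.
rewrite rmorphD !rmorphM !rmorphXn /= ev1x map_polyX map_polyC /= G'1 g'1.
by rewrite !expr1n !mul1r.
Qed.

Lemma ev0_ker (q : {poly {poly C}}) : ev 0 q = 0 ->
  q = 'X%:P * map_poly (fun p => p %/ 'X) q.
Proof.
move=> q0; apply/polyP => i; rewrite coefCM coef_map_id0 ?div0p // mulrC divpK //.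
by rewrite -[X in X %| _]subr0 -polyC0 dvdp_XsubCl rootE -coef_ev q0 coef0.
Qed.

(** Homogenizing [P = G * H] yields a factorization of [R] up to powers of [xvar]. As [xvar] is
    prime, these powers can be stripped, and irreducibility makes one of the remaining factors a
    unit. *)
Lemma irreducible_cofactor n (A : 'M[C]_n) (c : 'I_n -> C) (P G H : {poly {poly C}}) :
    r_irreducible A c -> (forall y, ev y P = pc (A + y *: adjmx A) c) ->
    P = G * H -> (1 < size G)%N ->
  (size H <= 1)%N.
Proof.
move=> [R [Rr [_ [_ Rirr]]]] evP PGH szG.
have [N1 [G' [EG' G'1]]] := homogenize2 G; have [N2 [H' [EH' H'1]]] := homogenize2 H.
have ER x y t : x != 0 -> eval3 x y t R = x ^+ degc c * (ev (y / x) P).[t / x].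
  move=> nz_x; rewrite /eval3 Rr evP -pc_scale //.
  have -> : x * (t / x) = t by rewrite mulrC divfK.
  by rewrite scalerDr scalerA [x * (y / x)]mulrC divfK.
have GHR : (G' * xvar ^+ degc c) * H' = xvar ^+ (N1 + N2) * R.
  apply: eval3_inj => x y t nz_x.
  rewrite !rmorphM !rmorphXn /= eval3_xvar EG' // EH' // ER // PGH rmorphM hornerM.
  rewrite exprD; move: (ev _ G).[_] (ev _ H).[_] (x ^+ degc c) => a b w.
  by ring.
(* Evaluation at [x = 0], whose kernel is generated by [xvar]. *)
pose f : {rmorphism {poly {poly {poly C}}} -> {poly {poly C}}} := map_poly (ev 0).
have kerf p : f p = 0 -> exists p', p = xvar * p'.
  move=> fp; exists (map_poly (map_poly (fun p => p %/ 'X)) p).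
  apply/polyP => i; rewrite coefCM coef_map_id0 ?map_poly0 //.
  by apply: ev0_ker; rewrite -coef_map [map_poly _ _]fp coef0.
have fx : f xvar = 0 by rewrite /f /= map_polyC /= evC hornerX.
have nz_x : xvar != 0 by rewrite !polyC_eq0 polyX_eq0.
have [i [j [P' [Q' [PE QE PQ]]]]] := prime_strip_exp kerf fx nz_x GHR.
(* Setting [x = 1] undoes the homogenization and erases the powers of [xvar]. *)
have ev1x : map_poly (ev 1) xvar = 1 :> {poly {poly C}}.
  by rewrite /xvar map_polyC /= evC hornerX.
have unit_size (U : {poly {poly {poly C}}}) : U \is a GRing.unit ->
    (size (map_poly (ev 1) U) <= 1)%N.
  by rewrite poly_unitE => /andP[/eqP sU _]; apply: leq_trans (size_poly _ _) (eq_leq sU).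
have [/unit_size|/unit_size] := Rirr _ _ (esym PQ).
  have -> : map_poly (ev 1) P' = G.
    have := congr1 (map_poly (ev 1)) PE.
    by rewrite !rmorphM !rmorphXn /= ev1x !expr1n mul1r mulr1 G'1.
  by rewrite leqNgt szG.
have -> // : map_poly (ev 1) Q' = H.
have := congr1 (map_poly (ev 1)) QE.
by rewrite !rmorphM !rmorphXn /= ev1x !expr1n mul1r H'1.
Qed.

End Homogenize.

(** * Intersection points from the common supporting lines *)

Unset Implicit Arguments.

Theorem mainTheorem10 (C : numClosedFieldType) (n m : nat)
  (A : 'M[C]_n) (B : 'M[C]_m) (c : 'I_n -> C) (d : 'I_m -> C)
  (hc : forall i, c i \is Num.real) (hd : forall i, d i \is Num.real)
  (hWA : exists z, Wrange A c z) (hWB : exists z, Wrange B d z)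
  (k : nat) (L : 'I_k -> C -> Prop)
  (hk : (degc c * degc d < k)%N)
  (hLdist : forall i j, (forall z, L i z <-> L j z) -> i = j)
  (hLsupp : forall i, common_supporting_line (Wrange A c) (Wrange B d) (L i))
  (h1 : (forall z, Wrange A c z <-> Wc A c z) \/
        ((exists p, interior_point (Wrange A c) p) /\
         forall i, exists p, L i p /\ smooth_boundary_at (Wrange A c) p))
  (h2 : (forall z, Wrange B d z <-> Wc B d z) \/
        ((exists p, interior_point (Wrange B d) p) /\
         forall i, exists p, L i p /\ smooth_boundary_at (Wrange B d) p)) :
  (exists v, c_value A c v /\ c_value B d v) /\
  (r_irreducible A c -> forall v, c_value A c v -> c_value B d v).
Proof.
have /fin_all_exists[ut hut] (i : 'I_k) : exists ut : C * C,
    [/\ `|ut.1| = 1, forall z, L i z <-> line_of ut.1 ut.2 z,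
        sup A c ut.1 = ut.2 & sup B d ut.1 = ut.2].
  have [u [t [u1 tR LE Kt]]] := common_supporting_line_normalize (hLsupp i).
  have [tA [tB _]] := hLsupp i.
  exists (u, t); split => //=.
    apply: (support_value hc u1 tR LE) => //; first by move=> z Wz; apply: Kt; left.
    by case: h1 => [|[? /(_ i)]]; [left | right].
  apply: (support_value hd u1 tR LE) => //; first by move=> z Wz; apply: Kt; right.
  by case: h2 => [|[? /(_ i)]]; [left | right].
have [P [mP sP wP evP]] := exists_rpoly c A (adjmx A).
have [Q [mQ sQ wQ evQ]] := exists_rpoly d B (adjmx B).
pose pt (i : 'I_k) : C * C := ((ut i).1^* ^+ 2, 2%:R * (ut i).1^* * (ut i).2).
have pt_inj : injective pt.
  move=> i j [e1 e2]; apply: hLdist => z.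
  have [ui Li _ _] := hut i; have [_ Lj _ _] := hut j.
  by rewrite Li Lj; exact: same_pencil_point.
have rP i : root (ev (pt i).1 P) (pt i).2.
  have [u1 _ tE _] := hut i; rewrite evP /= -tE.
  by apply: root_pencil => //; exact: heig_sum_root.
have rQ i : root (ev (pt i).1 Q) (pt i).2.
  have [u1 _ _ tE] := hut i; rewrite evQ /= -tE.
  by apply: root_pencil => //; exact: heig_sum_root.
have [G [H [H' [PE QE szG]]]] :=
  gcdp_common_factor (bezout_gcdp mP mQ sP sQ wP wQ pt_inj rP rQ hk).
have P0 v : root (ev 0 P) v <-> c_value A c v.
  by rewrite evP scale0r addr0; exact: root_pcP.
have Q0 v : root (ev 0 Q) v <-> c_value B d v.
  by rewrite evQ scale0r addr0; exact: root_pcP.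
have GQ v : root (ev 0 G) v -> c_value B d v.
  by move=> rG; apply/Q0; rewrite QE rmorphM rootM rG.
split.
  have /closed_rootP [v rG] : size (ev 0 G) != 1%N.
    by rewrite (size_ev_factor 0 mP PE) gtn_eqF.
  by exists v; split; [apply/P0; rewrite PE rmorphM rootM rG | exact: GQ].
move=> Airr v /P0; rewrite PE rmorphM /= rootM => /orP[/GQ //|].
(* [H] has degree 0 in [w] and its leading coefficient has no zero, so [ev 0 H] is a nonzero
   constant: the root [v] cannot come from [H]. *)
have HG : P = H * G by rewrite PE mulrC.
have := irreducible_cofactor Airr evP PE szG; rewrite -(size_ev_factor 0 mP HG) => sH.
have nzH : ev 0 H != 0.
  rewrite -size_poly_eq0 (size_ev_factor 0 mP HG) size_poly_eq0.
  by apply: contraTneq mP => H0; rewrite HG H0 mul0r monicE lead_coef0 eq_sym oner_eq0.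
have [h hE] : exists h, ev 0 H = h%:P by exists (ev 0 H)`_0; exact: size1_polyC.
by rewrite hE rootC -polyC_eq0 -hE (negbTE nzH).
Qed.
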